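(* Suppose the primal-dual Slater condition holds for the conic linear problem $\min\{c^\top x: Ax=b,\ x\in K_p\}$, that is, there exist $x\in V_p\cap\operatorname{int}K_p$ and $s\in V_d\cap\operatorname{int}K_d$. Suppose that $c\in\mathcal L=\operatorname{Null}(A)$ and that rPDHG is run from $z^{0,0}=(x^{0,0},y^{0,0})=(0,0)$ using the $\beta$-restart condition with $\beta:=1/e$ and the step-sizes $\tau=\tau_0:=1/\kappa$ and $\sigma=\sigma_0:=1/(\lambda_{\max}\lambda_{\min})$. Given $\varepsilon_{\mathrm{cons}},\varepsilon_{\mathrm{gap}}>0$, let $T$ be the total number of OnePDHG iterations that are run in order to obtain (the first) $n$ for which $w^{n,0}=(x^{n,0},s^{n,0})$ satisfies $\mathrm{E}_{\mathrm{cons}}(w^{n,0})\le\varepsilon_{\mathrm{cons}}$ and $\mathrm{E}_{\mathrm{gap}}(w^{n,0})\le\varepsilon_{\mathrm{gap}}$. Then for every $\delta>0$, $$T\le T_\delta:=99\,\kappa\,\frac{D_\delta}{r_\delta}\,\ln\!\left(17\,\kappa\,\operatorname{Dist}(0,\mathcal W^\star)\Big(\tfrac{1}{\varepsilon_{\mathrm{cons}}}\vee\tfrac{2\sqrt2\,\operatorname{Dist}(0,\mathcal W^\star)}{\varepsilon_{\mathrm{gap}}}\Big)\right)+26\,\kappa\,d^H_\delta\Big(\tfrac{1}{\varepsilon_{\mathrm{cons}}}\vee\tfrac{2\sqrt2\,\operatorname{Dist}(0,\mathcal W^\star)}{\varepsilon_{\mathrm{gap}}}\Big),$$ and consequentl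y $T\le\inf_{\delta>0}T_\delta$.
   Context: Problem. $K_p\subseteq\mathbb R^n$ is a closed convex cone, $K_d:=K_p^*=\{s:x^\top s\ge0\ \forall x\in K_p\}$, $A\in\mathbb R^{m\times n}$ ($A\ne0$, rows not assumed independent), $b\in\mathbb R^m$, $c\in\mathbb R^n$. The primal problem is $\min\{c^\top x:Ax=b,x\in K_p\}$. $\|\cdot\|$ is the Euclidean norm, $\operatorname{Dist}$ is Euclidean distance to a set, $B(w,r)$ is the Euclidean ball, $a\vee b=\max\{a,b\}$. $\mathcal L:=\operatorname{Null}(A)$, $\mathcal L^\perp=\operatorname{Im}(A^\top)$, $q:=A^\top(AA^\top)^\dagger b$ (Moore-Penrose inverse), $V_p:=\{x:Ax=b\}$, $V_d:=c+\operatorname{Im}(A^\top)$, $V:=V_p\times V_d$, $K:=K_p\times K_d$, $\mathcal F:=V\cap K$. For $w=(x,s)\in\mathbb R^{2n}$, and with $c\in\mathcal L$, $\operatorname{Gap}(w):=c^\top x+q^\top s$. $\mathcal W^\star:=\mathcal F\cap\{w:\operatorname{Gap}(w)=0\}$ (the primal-dual optimal set). $\lambda_{\max},\lambda_{\min}$ are the largest and smallest positive singular values of $A$, and $\kappa:=\lambda_{\max}/\lambda_{\min}$. Level-set measures. For $\delta>0$: $\mathcal W_\delta:=\mathcal F\cap\{w:\operatorname{Gap}(w)\le\delta\}$; diameter $D_\delta:=\max_{u,v\in\mathcal W_\delta}\|u-v\|$; conic radius $r_\delta:=\max\{r\ge0: w\in\mathcal W_\delta,\ B(w,r)\subseteq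 K\}$ (maximum over $w$ and $r$); $d^H_\delta:=\max_{w\in\mathcal W_\delta}\operatorname{Dist}(w,\mathcal W^\star)$. Errors. $\mathrm{E}_{\mathrm{cons}}(w):=\max\{\operatorname{Dist}(w,V),\operatorname{Dist}(w,K)\}$, $\mathrm{E}_{\mathrm{gap}}(w):=\max\{0,\operatorname{Gap}(w)\}$. Algorithm. $L(x,y):=c^\top x+b^\top y-x^\top A^\top y$. For $z=(x,y)$, OnePDHG$(z)=(x^+,y^+)$ with $x^+=P_{K_p}(x-\tau(c-A^\top y))$ (Euclidean projection), $y^+=y+\sigma(b-A(2x^+-x))$. With $M:=\begin{pmatrix}\frac1\tau I_n & A^\top \\ A & \frac1\sigma I_m\end{pmatrix}\succeq0$, $\|z\|_M:=\sqrt{z^\top Mz}$. The normalized duality gap of $z=(x,y)\in K_p\times\mathbb R^m$ is, for $r>0$, $\rho(r;z):=\frac1r\sup\{L(x,\hat y)-L(\hat x,y):\hat x\in K_p,\ \|(\hat x,\hat y)-z\|_M\le r\}$. rPDHG: for outer iterations $n=0,1,2,\dots$, set $z^{n,k+1}=\text{OnePDHG}(z^{n,k})$ and $\bar z^{n,k}=\frac1k\sum_{i=1}^kz^{n,i}$ for $k\ge1$; at the first $k\ge1$ for which $(n,k)$ satisfies the restart condition, set $z^{n+1,0}:=\bar z^{n,k}$ and pass to outer iteration $n+1$. The $\beta$-restart condition ($\beta\in(0,1)$) holds at $(n,k)$ if $n=0$ and $k=1$, or if $n\ge1$ and $\rho(\|\bar z^{n,k}-z^{n,0}\|_M;\bar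 z^{n,k})\le\beta\,\rho(\|z^{n,0}-z^{n-1,0}\|_M;z^{n,0})$. Write $z^{n,k}=(x^{n,k},y^{n,k})$, $s^{n,k}:=c-A^\top y^{n,k}$, $w^{n,k}:=(x^{n,k},s^{n,k})$.
   Formalization: The bounds are proved as T ≤ max(0, T_δ) and T ≤ max(0, inf T_δ), since for large tolerances the starting point is already acceptable (T = 0) while the logarithm makes T_δ negative; whenever T ≥ 1 the stated bounds hold literally. *)

(* Defs.v *)
From mathcomp Require Import all_boot all_order all_algebra.
From mathcomp Require Import all_classical all_reals all_analysis.

Set Implicit Arguments.
Unset Strict Implicit.
Unset Printing Implicit Defensive.

Import Order.TTheory GRing.Theory Num.Theory.
Import numFieldNormedType.Exports.

Local Open Scope classical_set_scope.
Local Open Scope ring_scope.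

(* Vectors are columns. A primal-dual pair (x, s) or (x, y) is the stacked
   column [col_mx x s]; its components are [usubmx] and [dsubmx]. The library
   norm on matrices is the max norm, hence the explicit Euclidean norm below;
   the topology ([closed], [interior]) is the same for both. *)

Section Euclidean.
Variables (R : realType) (k : nat).
Implicit Types (u v w : 'cV[R]_k) (S : set 'cV[R]_k).

Definition dot u v : R := (u^T *m v) 0 0.

Definition enorm u : R := Num.sqrt (dot u u).

Definition eball w (r : R) : set 'cV[R]_k := [set v | enorm (v - w) <= r].

Definition Dist w S : R := inf [set enorm (w - v) | v in S].

Definition diam S : R := sup [set d | exists u v, [/\ S u, S v & d = enorm (u - v)]].

(* The Euclidean projection: a point of S minimizing the distance to w (it
   exists and is unique when S is nonempty, closed and convex). *)
Definition proj S w : 'cV[R]_k :=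
  xget 0 [set p | S p /\ forall v, S v -> enorm (w - p) <= enorm (w - v)].

Definition closed_convex_cone S : Prop :=
  [/\ S !=set0, closed S, convex_set S
    & forall (t : R) v, 0 <= t -> S v -> S (t *: v)].

Definition dual_cone S : set 'cV[R]_k :=
  [set s | forall x, S x -> 0 <= dot x s].

End Euclidean.

Section MatrixNotions.
Variable R : realType.

Definition pos_singular_values m n (A : 'M[R]_(m, n)) : set R :=
  [set s | 0 < s /\ eigenvalue (A^T *m A) (s ^+ 2)].

(* The set is finite, and nonempty when A != 0, so these are a maximum and a
   minimum. *)
Definition lambda_max m n (A : 'M[R]_(m, n)) : R := sup (pos_singular_values A).
Definition lambda_min m n (A : 'M[R]_(m, n)) : R := inf (pos_singular_values A).

Definition kappa m n (A : 'M[R]_(m, n)) : R := lambda_max A / lambda_min A.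

(* The four Penrose equations, which have exactly one solution. *)
Definition penrose m n (A : 'M[R]_(m, n)) (X : 'M[R]_(n, m)) : Prop :=
  [/\ A *m X *m A = A, X *m A *m X = X,
      (A *m X)^T = A *m X & (X *m A)^T = X *m A].

Definition mpinv m n (A : 'M[R]_(m, n)) : 'M[R]_(n, m) := xget 0 (penrose A).

End MatrixNotions.

Section ConicProgram.
Variables (R : realType) (m n : nat).
Variables (Kp : set 'cV[R]_n) (A : 'M[R]_(m, n)) (b : 'cV[R]_m) (c : 'cV[R]_n).

Definition Kd : set 'cV[R]_n := dual_cone Kp.

Definition q : 'cV[R]_n := A^T *m mpinv (A *m A^T) *m b.

Definition Vp : set 'cV[R]_n := [set x | A *m x = b].

Definition Vd : set 'cV[R]_n := [set s | exists y, s = c + A^T *m y].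

Definition V : set 'cV[R]_(n + n) := [set w | Vp (usubmx w) /\ Vd (dsubmx w)].

Definition K : set 'cV[R]_(n + n) := [set w | Kp (usubmx w) /\ Kd (dsubmx w)].

Definition F : set 'cV[R]_(n + n) := V `&` K.

Definition slater : Prop := Vp `&` interior Kp !=set0 /\ Vd `&` interior Kd !=set0.

Definition Gap (w : 'cV[R]_(n + n)) : R := dot c (usubmx w) + dot q (dsubmx w).

Definition Wstar : set 'cV[R]_(n + n) := F `&` [set w | Gap w = 0].

Definition Wlevel (delta : R) : set 'cV[R]_(n + n) :=
  F `&` [set w | Gap w <= delta].

Definition D (delta : R) : R := diam (Wlevel delta).

Definition conic_radius (delta : R) : R :=
  sup [set r | 0 <= r /\ exists2 w, Wlevel delta w & eball w r `<=` K].

Definition dH (delta : R) : R := sup [set Dist w Wstar | w in Wlevel delta].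

Definition Econs (w : 'cV[R]_(n + n)) : R := Num.max (Dist w V) (Dist w K).

Definition Egap (w : 'cV[R]_(n + n)) : R := Num.max 0 (Gap w).

Definition Lagrangian (x : 'cV[R]_n) (y : 'cV[R]_m) : R :=
  dot c x + dot b y - dot x (A^T *m y).

Section PDHG.
Variables (tau sigma : R).

Definition OnePDHG (z : 'cV[R]_(n + m)) : 'cV[R]_(n + m) :=
  let x := usubmx z in let y := dsubmx z in
  let x' := proj Kp (x - tau *: (c - A^T *m y)) in
  let y' := y + sigma *: (b - A *m (2 *: x' - x)) in
  col_mx x' y'.

Definition Mpdhg : 'M[R]_(n + m) :=
  block_mx (tau^-1)%:M A^T A (sigma^-1)%:M.

Definition Mnorm (z : 'cV[R]_(n + m)) : R := Num.sqrt (dot z (Mpdhg *m z)).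

(* Mpdhg may be singular, so the feasible set of the supremum may be unbounded
   and the value is an extended real. For r = 0 the conventions 0^-1 = 0 and
   0 * +oo = 0 give rho 0 z = 0. *)
Definition rho (r : R) (z : 'cV[R]_(n + m)) : \bar R :=
  ((r^-1)%:E * ereal_sup
    [set (Lagrangian (usubmx z) (dsubmx zh) - Lagrangian (usubmx zh) (dsubmx z))%R%:E
       | zh in [set zh : 'cV[R]_(n + m) | Kp (usubmx zh) /\ (Mnorm (zh - z) <= r)%R]])%E.

(* Average of the first k OnePDHG iterates issued from z. *)
Definition pdhg_avg (z : 'cV[R]_(n + m)) (k : nat) : 'cV[R]_(n + m) :=
  k%:R^-1 *: \sum_(1 <= i < k.+1) iter i OnePDHG z.

(* [z N] stands for z^{N,0}. *)
Definition restart_cond (beta : R) (z : nat -> 'cV[R]_(n + m)) (N k : nat) : Prop :=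
  (N = 0%N /\ k = 1%N) \/
  ((1 <= N)%N /\
   (rho (Mnorm (pdhg_avg (z N) k - z N)) (pdhg_avg (z N) k)
    <= beta%:E * rho (Mnorm (z N - z N.-1)) (z N))%E).

Definition first_restart (beta : R) (z : nat -> 'cV[R]_(n + m)) (N k : nat) : Prop :=
  [/\ (1 <= k)%N, restart_cond beta z N k
    & forall j, (1 <= j < k)%N -> ~ restart_cond beta z N j].

(* z 0, ..., z N are the starting points of the first outer iterations of rPDHG
   run from z0, and l i is the number of OnePDHG iterations spent in the i-th
   one. *)
Definition rPDHG_run (beta : R) (z0 : 'cV[R]_(n + m)) (N : nat)
    (z : nat -> 'cV[R]_(n + m)) (l : nat -> nat) : Prop :=
  z 0%N = z0 /\
  forall i, (i < N)%N ->
    first_restart beta z i (l i) /\ z i.+1 = pdhg_avg (z i) (l i).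

Definition w_of_z (z : 'cV[R]_(n + m)) : 'cV[R]_(n + n) :=
  col_mx (usubmx z) (c - A^T *m dsubmx z).

Definition within_tol (epscons epsgap : R) (z : 'cV[R]_(n + m)) : Prop :=
  Econs (w_of_z z) <= epscons /\ Egap (w_of_z z) <= epsgap.

(* T OnePDHG iterations are run to reach the first outer iteration whose
   starting point meets the tolerances. *)
Definition total_iterations (beta : R) (z0 : 'cV[R]_(n + m))
    (epscons epsgap : R) (T : nat) : Prop :=
  exists N z l,
    [/\ rPDHG_run beta z0 N z l,
        within_tol epscons epsgap (z N),
        forall i, (i < N)%N -> ~ within_tol epscons epsgap (z i)
      & T = (\sum_(0 <= i < N) l i)%N].

End PDHG.

Definition inv_tol (epscons epsgap : R) : R :=
  Num.max (1 / epscons) (2 * Num.sqrt 2 * Dist 0 Wstar / epsgap).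

Definition Tbound (epscons epsgap delta : R) : R :=
  99 * kappa A * (D delta / conic_radius delta)
     * ln (17 * kappa A * Dist 0 Wstar * inv_tol epscons epsgap)
  + 26 * kappa A * dH delta * inv_tol epscons epsgap.

End ConicProgram.

(* Main.v *)
(* The normalized duality gap P of an outer iterate, measured at the radius of
   its last restart, controls both the infeasibilities (by xi = sqrt(kappa) P)
   and the objective gap (by 2 sqrt 2 xi d0, with d0 the distance from 0 to the
   optimal set). Conversely, averages of k PDHG steps issued from z have
   normalized gap at most 4 dist_M(z, optimal set) / k, and
   dist_M <= sqrt(2 kappa) dist. The level set enters through an error bound:
   moving a point with residuals xi towards the center of a ball of radius
   r_delta of the cone, and towards an optimal point to lower the gap, reaches
   the level set after a displacement of at most (2 + 2 sqrt 2) xi D_delta /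
   r_delta, so dist <= (3 + 2 sqrt 2) xi D_delta / r_delta + dH_delta. Hence an
   outer iteration has length O(kappa (D_delta / r_delta + dH_delta / xi)), and
   since xi decreases by the factor e at each restart, the second terms form a
   geometric sum dominated by the last xi, which exceeds the tolerance. *)
Require Import Defs.
From mathcomp Require Import all_boot all_order all_algebra.
From mathcomp Require Import all_classical all_reals all_analysis.
From mathcomp Require Import ring lra.
Import Order.TTheory GRing.Theory Num.Theory.
Import numFieldNormedType.Exports.
Local Open Scope classical_set_scope.
Local Open Scope ring_scope.

Set Implicit Arguments.
Unset Strict Implicit.
Unset Printing Implicit Defensive.

(** * Euclidean and seminorm inequalities *)

(** The step-sizes satisfy [tau sigma lambda_max^2 = 1], the boundary case: the PDHG metric is only
    a seminorm, the supremum in [rho] may range over an unbounded set, and a restart may have radius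
    0. For averages of PDHG steps [rho] is still finite, because the gap of an average is bounded by
    an M-distance; radius 0 is settled by linearity of the gap along segments. The seminorm is
    controlled by the Euclidean distance of the pairs (x, s) only when y lies in Im A; this holds
    along the run, which starts at y = 0 with b in Im A, and optimal multipliers can be chosen so.
    An optimal pair is obtained from the Slater points by regularization. Constants: after the
    first, an outer iteration that does not start within tolerance has length at most
    [1 + C ((3 + 2 sqrt 2) D/r + dH/xi)] with [C = 4 sqrt 2 e kappa]. From [e <= 2.9] and
    [sqrt 2 <= 17/12] follows [C (3 + 2 sqrt 2) <= 96 kappa]; the additive 1 and the single step of
    the first outer iteration raise 96 to 98. The geometric sum multiplies [C] by [e/(e - 1)],
    whence 26, and 17 bounds [4 sqrt 2 e]. *)

Section DotTheory.
Variables (R : realType) (k : nat).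
Implicit Types (u v w : 'cV[R]_k) (t : R).

Lemma dot_sum u v : dot u v = \sum_i u i 0 * v i 0.
Proof. by rewrite /dot mxE; apply: eq_bigr => i _; rewrite mxE. Qed.

Lemma dotC u v : dot u v = dot v u.
Proof. by rewrite !dot_sum; apply: eq_bigr => i _; rewrite mulrC. Qed.

Lemma dotDl u v w : dot (u + v) w = dot u w + dot v w.
Proof. by rewrite /dot linearD mulmxDl mxE. Qed.

Lemma dotDr u v w : dot u (v + w) = dot u v + dot u w.
Proof. by rewrite /dot mulmxDr mxE. Qed.

Lemma dotZl t u v : dot (t *: u) v = t * dot u v.
Proof. by rewrite /dot linearZ -scalemxAl mxE. Qed.

Lemma dotZr t u v : dot u (t *: v) = t * dot u v.
Proof. by rewrite /dot -scalemxAr mxE. Qed.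

Lemma dotNl u v : dot (- u) v = - dot u v.
Proof. by rewrite -scaleN1r dotZl mulN1r. Qed.

Lemma dotNr u v : dot u (- v) = - dot u v.
Proof. by rewrite -scaleN1r dotZr mulN1r. Qed.

Lemma dot0l v : dot 0 v = 0.
Proof. by rewrite /dot trmx0 mul0mx mxE. Qed.

Lemma dot0r v : dot v 0 = 0.
Proof. by rewrite /dot mulmx0 mxE. Qed.

Definition dotE := (dotDl, dotDr, dotNl, dotNr, dotZl, dotZr, dot0l, dot0r).

Lemma dot_ge0 u : 0 <= dot u u.
Proof. by rewrite dot_sum sumr_ge0 // => i _; rewrite -expr2 sqr_ge0. Qed.

Lemma dot_eq0 u : dot u u = 0 -> u = 0.
Proof.
rewrite dot_sum => /eqP.
rewrite psumr_eq0; last by move=> i _; rewrite -expr2 sqr_ge0.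
move=> /allP u0; apply/colP => i; rewrite mxE.
have := u0 i (mem_index_enum i).
by rewrite /= mulf_eq0 orbb => /eqP.
Qed.

End DotTheory.

Lemma dot_mulmx (R : realType) (m n : nat) (A : 'M[R]_(m, n)) x y :
  dot (A *m x) y = dot x (A^T *m y).
Proof. by rewrite /dot trmx_mul mulmxA. Qed.

Lemma dot_col_mx (R : realType) (m n : nat) (a c : 'cV[R]_m) (b d : 'cV[R]_n) :
  dot (col_mx a b) (col_mx c d) = dot a c + dot b d.
Proof. by rewrite /dot tr_col_mx mul_row_col mxE. Qed.

Lemma dot_split (R : realType) (m n : nat) (u v : 'cV[R]_(m + n)) :
  dot u v = dot (usubmx u) (usubmx v) + dot (dsubmx u) (dsubmx v).
Proof. by rewrite -dot_col_mx !vsubmxK. Qed.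

Section SemiNorm.
Variables (R : realType) (k : nat) (Q : 'M[R]_k).
Hypothesis Qsym : Q^T = Q.
Hypothesis Qpsd : forall v, 0 <= dot v (Q *m v).
Implicit Types u v : 'cV[R]_k.

Definition seminorm u : R := Num.sqrt (dot u (Q *m u)).

Lemma seminorm_ge0 u : 0 <= seminorm u.
Proof. exact: sqrtr_ge0. Qed.

Lemma seminorm_sqr u : seminorm u ^+ 2 = dot u (Q *m u).
Proof. by rewrite sqr_sqrtr. Qed.

Lemma bilin_sym u v : dot u (Q *m v) = dot v (Q *m u).
Proof. by rewrite dotC dot_mulmx Qsym. Qed.

Lemma form_cauchy u v : dot u (Q *m v) ^+ 2 <= dot u (Q *m u) * dot v (Q *m v).
Proof.
set a := dot u (Q *m u); set c := dot v (Q *m v); set b := dot u (Q *m v).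
have H t : 0 <= a + 2 * t * b + t ^+ 2 * c.
  have := Qpsd (u + t *: v).
  rewrite mulmxDr -scalemxAr !dotE (bilin_sym v u) -/a -/b -/c.
  by congr (_ <= _); ring.
have a0 : 0 <= a by exact: Qpsd.
have c0 : 0 <= c by exact: Qpsd.
have [cE|cN] := eqVneq c 0.
  have [bE|bN] := eqVneq b 0; first by rewrite bE cE; nra.
  (* With [c = 0] the quadratic is affine in [t], and this [t] gives it the value -1. *)
  have := H (- (a + 1) / (2 * b)); rewrite cE mulr0 addr0.
  suff -> : a + 2 * (- (a + 1) / (2 * b)) * b = -1 by rewrite ler0N1.
  by field.
have cpos : 0 < c by rewrite lt_neqAle eq_sym cN.
have := H (- b / c).
have -> : a + 2 * (- b / c) * b + (- b / c) ^+ 2 * c = (a * c - b ^+ 2) / c by field.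
by rewrite pmulr_lge0 ?invr_gt0// subr_ge0.
Qed.

Lemma cauchy_seminorm u v : dot u (Q *m v) <= seminorm u * seminorm v.
Proof.
rewrite -sqrtrM; last exact: Qpsd.
apply: le_trans (ler_norm _) _; rewrite -sqrtr_sqr ler_wsqrtr //.
exact: form_cauchy.
Qed.

Lemma seminormD u v : seminorm (u + v) <= seminorm u + seminorm v.
Proof.
rewrite -(ler_pXn2r (n := 2)) ?nnegrE ?addr_ge0 ?seminorm_ge0 //.
rewrite seminorm_sqr sqrrD !seminorm_sqr mulmxDr !dotE (bilin_sym v u).
have := cauchy_seminorm u v; lra.
Qed.

Lemma seminormZ t u : seminorm (t *: u) = `|t| * seminorm u.
Proof.
rewrite /seminorm -scalemxAr !dotE mulrA -expr2 sqrtrM ?sqr_ge0//.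
by rewrite sqrtr_sqr.
Qed.

Lemma seminormN u : seminorm (- u) = seminorm u.
Proof. by rewrite -scaleN1r seminormZ normrN1 mul1r. Qed.

Lemma seminormB u v : seminorm (u - v) = seminorm (v - u).
Proof. by rewrite -seminormN opprB. Qed.

Lemma seminorm_dist u v w :
  seminorm (u - w) <= seminorm (u - v) + seminorm (v - w).
Proof. by have := seminormD (u - v) (v - w); rewrite subrKA. Qed.

Lemma seminorm0 : seminorm 0 = 0.
Proof. by rewrite /seminorm dot0l sqrtr0. Qed.

Lemma seminorm_sum I (r : seq I) (P : pred I) (F : I -> 'cV[R]_k) :
  seminorm (\sum_(i <- r | P i) F i) <= \sum_(i <- r | P i) seminorm (F i).
Proof.
elim/big_ind2: _ => //; first by rewrite seminorm0.
by move=> x a y b xa yb; apply: le_trans (seminormD _ _) (lerD xa yb).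
Qed.

End SemiNorm.

Section EuclideanNorm.
Variables (R : realType) (k : nat).
Implicit Types u v w : 'cV[R]_k.

Let psd1 v : 0 <= dot v ((1%:M : 'M[R]_k) *m v).
Proof. by rewrite mul1mx dot_ge0. Qed.

Lemma enormE u : enorm u = seminorm 1%:M u.
Proof. by rewrite /seminorm mul1mx. Qed.

Lemma enorm_ge0 u : 0 <= enorm u.
Proof. exact: sqrtr_ge0. Qed.

Lemma enorm_sqr u : enorm u ^+ 2 = dot u u.
Proof. by rewrite sqr_sqrtr// dot_ge0. Qed.

Lemma enorm0 : enorm (0 : 'cV[R]_k) = 0.
Proof. by rewrite /enorm dot0l sqrtr0. Qed.

Lemma enorm_eq0 u : enorm u = 0 -> u = 0.
Proof. by move=> u0; apply: dot_eq0; rewrite -enorm_sqr u0 expr0n. Qed.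

Lemma dot_le_enorm u v : dot u v <= enorm u * enorm v.
Proof.
have := cauchy_seminorm (trmx1 _ _) psd1 u v.
by rewrite mul1mx -!enormE.
Qed.

Lemma dotN_le_enorm u v : - dot u v <= enorm u * enorm v.
Proof.
have := dot_le_enorm (- u) v; rewrite dotNl.
by rewrite [enorm (- u)]/enorm dotNl dotNr opprK.
Qed.

Lemma enormD u v : enorm (u + v) <= enorm u + enorm v.
Proof. by rewrite !enormE seminormD// trmx1. Qed.

Lemma enormZ t u : enorm (t *: u) = `|t| * enorm u.
Proof. by rewrite !enormE seminormZ. Qed.

Lemma enormN u : enorm (- u) = enorm u.
Proof. by rewrite !enormE seminormN. Qed.

Lemma enormB u v : enorm (u - v) = enorm (v - u).
Proof. by rewrite -enormN opprB. Qed.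

Lemma enorm_dist u v w : enorm (u - w) <= enorm (u - v) + enorm (v - w).
Proof. by have := enormD (u - v) (v - w); rewrite subrKA. Qed.

Lemma coord_le_enorm u i : `|u i 0| <= enorm u.
Proof.
rewrite -sqrtr_sqr ler_wsqrtr// dot_sum (bigD1 i)//= -expr2 lerDl.
by rewrite sumr_ge0 // => j _; rewrite -expr2 sqr_ge0.
Qed.

End EuclideanNorm.

Lemma enorm_col_mx_sqr (R : realType) (m n : nat) (a : 'cV[R]_m) (b : 'cV[R]_n) :
  enorm (col_mx a b) ^+ 2 = enorm a ^+ 2 + enorm b ^+ 2.
Proof. by rewrite !enorm_sqr dot_col_mx. Qed.

Lemma enorm_usub (R : realType) (m n : nat) (w : 'cV[R]_(m + n)) :
  enorm (usubmx w) <= enorm w.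
Proof. by rewrite ler_wsqrtr// [leRHS]dot_split lerDl dot_ge0. Qed.

Lemma enorm_dsub (R : realType) (m n : nat) (w : 'cV[R]_(m + n)) :
  enorm (dsubmx w) <= enorm w.
Proof. by rewrite ler_wsqrtr// [leRHS]dot_split lerDr dot_ge0. Qed.

(** [C] is the Frobenius norm: Cauchy-Schwarz on each row. *)
Lemma enorm_mulmx_le (R : realType) (m n : nat) (A : 'M[R]_(m, n)) :
  exists2 C, 0 <= C & forall v, enorm (A *m v) <= C * enorm v.
Proof.
pose C2 : R := \sum_i dot (row i A)^T (row i A)^T.
have C0 : 0 <= C2 by apply: sumr_ge0 => i _; exact: dot_ge0.
exists (Num.sqrt C2); first exact: sqrtr_ge0.
move=> v; rewrite /enorm -sqrtrM// ler_wsqrtr// dot_sum mulr_suml ler_sum// => i _.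
have -> : (A *m v) i 0 = dot (row i A)^T v.
  by rewrite /dot trmxK mxE -row_mul !mxE; apply: eq_bigr.
have := form_cauchy (trmx1 _ _) (fun v => _) (row i A)^T v.
rewrite !mul1mx expr2; apply => w; rewrite mul1mx; exact: dot_ge0.
Qed.

(** * Topology of column vectors *)

(* Continuity into column vectors is only ever used coordinatewise. *)
Definition coord_cont (R : realType) (T : topologicalType) (k : nat)
  (f : T -> 'cV[R]_k) := forall i, continuous (fun x => f x i 0).

Section CoordContinuity.
Variables (R : realType) (T : topologicalType).

Lemma coord_cont_cst k (v : 'cV[R]_k) : coord_cont (fun _ : T => v).
Proof. by move=> i; exact: cst_continuous. Qed.

Lemma coord_contD k (f g : T -> 'cV[R]_k) :
  coord_cont f -> coord_cont g -> coord_cont (fun x => f x + g x).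
Proof.
move=> cf cg i x; under [X in continuous_at _ X]funext do rewrite mxE.
by apply: cvgD; [exact: cf|exact: cg].
Qed.

Lemma coord_contN k (f : T -> 'cV[R]_k) :
  coord_cont f -> coord_cont (fun x => - f x).
Proof.
move=> cf i x; under [X in continuous_at _ X]funext do rewrite mxE.
by apply: cvgN; exact: cf.
Qed.

Lemma continuous_sum n (f : 'I_n -> T -> R) :
  (forall i, continuous (f i)) -> continuous (fun x => \sum_i f i x).
Proof. by move=> cf; apply: continuous_big => //; exact: add_continuous. Qed.

Lemma coord_cont_mulmx m k (A : 'M[R]_(m, k)) (f : T -> 'cV[R]_k) :
  coord_cont f -> coord_cont (fun x => A *m f x).
Proof.
move=> cf i; under [X in continuous X]funext do rewrite mxE.
apply: continuous_sum => j x; apply: cvgM; [exact: cvg_cst|exact: cf].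
Qed.

Lemma continuous_dot k (f g : T -> 'cV[R]_k) :
  coord_cont f -> coord_cont g -> continuous (fun x => dot (f x) (g x)).
Proof.
move=> cf cg; under [X in continuous X]funext do rewrite dot_sum.
by apply: continuous_sum => j x; apply: cvgM; [exact: cf|exact: cg].
Qed.

End CoordContinuity.

Section ColumnTopology.
Variable R : realType.

Lemma coord_cont_id k : coord_cont (fun x : 'cV[R]_k => x).
Proof. by move=> i; exact: coord_continuous. Qed.

Lemma coord_cont_usub m n : coord_cont (fun w : 'cV[R]_(m + n) => usubmx w).
Proof.
by move=> i; under [X in continuous X]funext do rewrite mxE; exact: coord_continuous.
Qed.

Lemma coord_cont_dsub m n : coord_cont (fun w : 'cV[R]_(m + n) => dsubmx w).
Proof.
by move=> i; under [X in continuous X]funext do rewrite mxE; exact: coord_continuous.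
Qed.

Lemma usubmx_continuous m n : continuous (fun w : 'cV[R]_(m + n) => usubmx w).
Proof.
move=> w S /nbhs_ballP[e /= e0 eS]; apply/nbhs_ballP; exists e => //= v [_ wv].
by apply: eS; split => // i j; rewrite !mxE; exact: wv.
Qed.

Lemma dsubmx_continuous m n : continuous (fun w : 'cV[R]_(m + n) => dsubmx w).
Proof.
move=> w S /nbhs_ballP[e /= e0 eS]; apply/nbhs_ballP; exists e => //= v [_ wv].
by apply: eS; split => // i j; rewrite !mxE; exact: wv.
Qed.

Lemma closed_usub m n (S : set 'cV[R]_m) : closed S ->
  closed [set w : 'cV[R]_(m + n) | S (usubmx w)].
Proof.
by move=> cS; apply: (preimage_closed _ cS) => w _; exact: usubmx_continuous.
Qed.

Lemma closed_dsub m n (S : set 'cV[R]_n) : closed S ->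
  closed [set w : 'cV[R]_(m + n) | S (dsubmx w)].
Proof.
by move=> cS; apply: (preimage_closed _ cS) => w _; exact: dsubmx_continuous.
Qed.

Lemma closed_fun_le (T : topologicalType) (f : T -> R) y : continuous f ->
  closed [set x | f x <= y].
Proof. by move=> cf; apply: (preimage_closed _ (@closed_le _ y)) => x _; exact: cf. Qed.

Lemma closed_fun_ge (T : topologicalType) (f : T -> R) y : continuous f ->
  closed [set x | y <= f x].
Proof. by move=> cf; apply: (preimage_closed _ (@closed_ge _ y)) => x _; exact: cf. Qed.

Lemma closed_coord_eq (T : topologicalType) k (f : T -> 'cV[R]_k) (v : 'cV[R]_k) :
  coord_cont f -> closed [set x | f x = v].
Proof.
move=> cf.
rewrite (_ : [set x | _] = [set x | dot (f x - v) (f x - v) <= 0]).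
  apply: closed_fun_le; apply: continuous_dot;
    by apply: coord_contD => //; exact: coord_cont_cst.
rewrite eqEsubset; split => x /=; first by move=> ->; rewrite subrr dot0l.
move=> d0; apply/eqP; rewrite -subr_eq0; apply/eqP/dot_eq0.
by apply/eqP; rewrite eq_le d0 dot_ge0.
Qed.

Lemma closed_enorm_bounded_compact k (S : set 'cV[R]_k) (B : R) :
  closed S -> (forall v, S v -> enorm v <= B) -> compact S.
Proof.
move=> cS bS.
(* Compactness comes from Heine-Borel for row vectors, transported along the transpose. *)
have trc p q : continuous (fun w : 'M[R]_(p, q) => w^T).
  move=> w U /nbhs_ballP[e /= e0 eU]; apply/nbhs_ballP; exists e => //= v [_ wv].
  by apply: eU; split => // i j; rewrite !mxE; exact: wv.
have -> : S = trmx @` ((fun v : 'rV[R]_k => v^T) @^-1` S).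
  rewrite eqEsubset; split => x /=; first by exists x^T; rewrite ?trmxK.
  by move=> [y Sy <-].
apply: continuous_compact; first by apply: continuous_subspaceT; exact: trc.
apply: bounded_closed_compact; last first.
  by apply: (preimage_closed _ cS) => w _; exact: trc.
exists B; split; first exact: num_real.
move=> M BM v /= Sv; rewrite [leLHS]mx_normrE.
have B0 : 0 <= B by apply: le_trans (bS _ Sv); exact: enorm_ge0.
apply/bigmax_leP; split=> [|[i j] _ /=]; first by apply: le_trans (ltW BM).
rewrite [i]ord1; apply: le_trans (ltW BM); apply: le_trans (bS _ Sv).
by have := coord_le_enorm v^T j; rewrite mxE.
Qed.

(** Only the sublevel set of [f x0] has to be bounded: a minimum over that compact set is a minimum
    over [S]. *)
Lemma closed_argmin k (S : set 'cV[R]_k) (f : 'cV[R]_k -> R) x0 (B : R) :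
  closed S -> S x0 -> continuous f ->
  (forall x, S x -> f x <= f x0 -> enorm x <= B) ->
  exists2 x, S x & forall y, S y -> f x <= f y.
Proof.
move=> cS Sx0 cf bf.
pose S' := S `&` [set x | f x <= f x0].
have S'0 : S' !=set0 by exists x0; split => //=.
have cS' : compact S'.
  apply: (@closed_enorm_bounded_compact _ _ B).
    by apply: closedI => //; exact: closed_fun_le.
  by move=> v [Sv fv]; exact: bf.
have [x] := compact_EVT_min S'0 cS' (continuous_subspaceT cf).
rewrite inE => -[Sx fx] xmin; exists x => // y Sy.
have [fy|/ltW fy] := leP (f y) (f x0); first by apply: xmin; rewrite inE.
exact: le_trans fx fy.
Qed.

Lemma interior_eball k (S : set 'cV[R]_k) x : interior S x ->
  exists2 r, 0 < r & eball x r `<=` S.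
Proof.
move=> /nbhs_ballP[e /= e0 eS]; exists (e / 2); first by rewrite divr_gt0.
move=> v; rewrite /eball /= => vx; apply: eS; split => // i j.
rewrite ord1 /ball /= ; have := coord_le_enorm (v - x) i.
rewrite !mxE distrC => /le_trans/(_ vx) h; apply: le_lt_trans h _; lra.
Qed.

End ColumnTopology.

(** * Closed convex cones and singular values *)

(** Divide by [t] and let [t] tend to 0. This is the first-order condition behind the variational
    arguments below, where the objective is exactly quadratic along a segment. *)
Lemma ge0_quad_lin (R : realType) (a b : R) :
  (forall t, 0 < t -> t <= 1 -> 0 <= t * b + t ^+ 2 * a) -> 0 <= b.
Proof.
move=> H; rewrite leNgt; apply/negP => b0.
(* Small enough that [t |a| <= - b / 2], so that [b + t a] is still negative. *)
pose t := Num.min 1 (- b / (2 * (`|a| + 1))).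
have a0 : 0 < 2 * (`|a| + 1) by have := normr_ge0 a; lra.
have t0 : 0 < t by rewrite lt_min ltr01 divr_gt0// oppr_gt0.
have t1 : t <= 1 by rewrite ge_min lexx.
have tb : t * (2 * (`|a| + 1)) <= - b.
  by rewrite -ler_pdivlMr// ge_min lexx orbT.
have := H t t0 t1; have -> : t * b + t ^+ 2 * a = t * (b + t * a) by ring.
rewrite pmulr_rge0// => h.
have := ler_norm a; nra.
Qed.

Section ClosedConvexCone.
Variables (R : realType) (n : nat) (S : set 'cV[R]_n).
Hypothesis hS : closed_convex_cone S.

Lemma coneZ t v : 0 <= t -> S v -> S (t *: v).
Proof. by case: hS => _ _ _ h; exact: h. Qed.

Lemma cone0 : S 0.
Proof. by case: (hS) => -[v Sv] _ _ _; rewrite -(scale0r v); exact: coneZ. Qed.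

(** Convexity gives the midpoint, and homogeneity doubles it. *)
Lemma coneD u v : S u -> S v -> S (u + v).
Proof.
case: (hS) => _ _ cS _ Su Sv.
have h0 : 0 <= 2^-1 :> R by rewrite invr_ge0.
have h1 : 2^-1 <= 1 :> R by rewrite invf_le1// ler1n.
have := cS u v (Itv01 h0 h1); rewrite !inE => /(_ Su Sv) /(coneZ (ler0n _ 2)).
rewrite /conv/= scalerDr !scalerA; congr S; congr (_ + _).
  by rewrite mulfV// scale1r.
by rewrite (_ : _ * _ = 1 :> R) ?scale1r// mulrBr mulr1 mulfV//; ring.
Qed.

Lemma cone_sum I (r : seq I) (P : pred I) (F : I -> 'cV[R]_n) :
  (forall i, P i -> S (F i)) -> S (\sum_(i <- r | P i) F i).
Proof. by move=> SF; elim/big_ind: _ => //; [exact: cone0|exact: coneD]. Qed.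

(** Existence of a nearest point, which rules out the default branch of [xget] in [proj]. *)
Lemma proj_spec w : S (Defs.proj S w) /\
  forall v, S v -> enorm (w - Defs.proj S w) <= enorm (w - v).
Proof.
rewrite /Defs.proj; case: xgetP => [p _ //|noproj]; exfalso.
have [_ cS _ _] := hS.
pose f (v : 'cV[R]_n) := dot (w - v) (w - v).
have cf : continuous f.
  apply: continuous_dot; apply: coord_contD; first exact: coord_cont_cst;
  try exact: coord_cont_cst; apply: coord_contN; exact: coord_cont_id.
(* Points at least as close to [w] as 0 have norm at most [2 |w|], which bounds the sublevel set. *)
have [v Sv fv|p Sp pmin] := @closed_argmin _ _ S f 0 (2 * enorm w) cS cone0 cf.
  have fv' : enorm (w - v) <= enorm w.
    by rewrite ler_wsqrtr//; move: fv; rewrite /f subr0.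
  have := enormD w (- (w - v)); rewrite enormN opprB addrC subrK; lra.
apply: (noproj p); split => // v Sv.
by rewrite ler_wsqrtr// pmin.
Qed.

Lemma proj_in w : S (Defs.proj S w).
Proof. by case: (proj_spec w). Qed.

Lemma proj_le0 w v : S v -> dot (w - Defs.proj S w) (v - Defs.proj S w) <= 0.
Proof.
have [Sp pmin] := proj_spec w; set p := Defs.proj S w in Sp pmin * => Sv.
(* Compare [p] with [p + t (v - p)] and keep the first-order term. *)
suff : 0 <= - (2 * dot (w - p) (v - p)) by lra.
apply: (@ge0_quad_lin _ (dot (v - p) (v - p))) => t t0 t1.
have Su : S ((1 - t) *: p + t *: v).
  by apply: coneD; apply: coneZ => //; lra.
have := pmin _ Su; rewrite -(ler_pXn2r (n := 2)) ?nnegrE ?enorm_ge0// !enorm_sqr.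
have -> : w - ((1 - t) *: p + t *: v) = (w - p) - t *: (v - p).
  by apply/colP => i; rewrite !mxE; ring.
move: (w - p) (v - p) => a d.
have -> : dot (a - t *: d) (a - t *: d)
    = dot a a - 2 * t * dot a d + t ^+ 2 * dot d d.
  by rewrite !dotE (dotC d a); ring.
lra.
Qed.

(** Moreau decomposition. The variational inequality at 0 and at twice the projection gives
    orthogonality; at an arbitrary [v] it then gives membership in the dual cone. *)
Lemma proj_moreau w :
  dual_cone S (Defs.proj S w - w) /\ dot (Defs.proj S w) (Defs.proj S w - w) = 0.
Proof.
have Sp := proj_in w; have pvar := @proj_le0 w; set p := Defs.proj S w in Sp pvar *.
have h0 := pvar 0 cone0.
have h2 := pvar (2 *: p) (coneZ (ler0n _ 2) Sp).
rewrite !dotE in h0 h2.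
have e0 : dot p (p - w) = 0.
  rewrite !dotE (dotC p w); lra.
split=> // v Sv.
have := pvar v Sv; rewrite !dotE in e0 *.
rewrite (dotC v p) (dotC v w); rewrite (dotC p w) in e0; lra.
Qed.

End ClosedConvexCone.

Section DualCone.
Variables (R : realType) (n : nat) (S : set 'cV[R]_n).

Lemma dual_cone_closed : closed (dual_cone S).
Proof.
have -> : dual_cone S = \bigcap_(x in S) [set s | 0 <= dot x s].
  by rewrite eqEsubset; split => s h x Sx; exact: h.
apply: closed_bigI => x _; apply: closed_fun_ge.
apply: continuous_dot; [exact: coord_cont_cst|exact: coord_cont_id].
Qed.

Lemma dual_coneD u v : dual_cone S u -> dual_cone S v -> dual_cone S (u + v).
Proof. by move=> Su Sv x Sx; rewrite dotDr addr_ge0 ?Su ?Sv. Qed.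

Lemma dual_coneZ t v : 0 <= t -> dual_cone S v -> dual_cone S (t *: v).
Proof. by move=> t0 Sv x Sx; rewrite dotZr mulr_ge0 ?Sv. Qed.

End DualCone.

(** Evaluate at [s - (r / |x|) x], the point of the ball where the product with [x] is smallest. *)
Lemma eball_dot_ge (R : realType) (n : nat) (x s : 'cV[R]_n) (r : R) :
  0 <= r -> (forall v, eball s r v -> 0 <= dot x v) -> r * enorm x <= dot x s.
Proof.
move=> r0 H.
have [x0|xN] := eqVneq (enorm x) 0.
  by rewrite x0 mulr0 (enorm_eq0 x0) dot0l.
have := H (s - (r / enorm x) *: x); rewrite /eball /=.
have -> : s - (r / enorm x) *: x - s = - ((r / enorm x) *: x).
  by rewrite addrAC subrr add0r.
rewrite enormN enormZ normrM (ger0_norm r0) normfV ger0_norm ?enorm_ge0//.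
rewrite divfK// lexx => /(_ isT); rewrite dotDr dotNr dotZr -enorm_sqr.
by rewrite expr2 mulrA divfK// subr_ge0.
Qed.

Section MatrixSpectrum.
Variables (R : realType).

(** The orthogonal complement of Null A is Im A^T. The columns of the cokernel matrix are null
    vectors of A and already detect the row space. *)
Lemma im_trmxP m n (A : 'M[R]_(m, n)) (u : 'cV[R]_n) :
  (forall v, A *m v = 0 -> dot u v = 0) -> exists y, u = A^T *m y.
Proof.
move=> H; suff : (u^T <= A)%MS.
  by move=> /submxP[D uD]; exists D^T; rewrite -[u]trmxK uD trmx_mul.
rewrite submxE; apply/eqP/rowP => j; rewrite [RHS]mxE.
have := H (col j (cokermx A)); rewrite colE mulmxA mulmx_coker mul0mx => /(_ erefl).
rewrite -colE => uj0; rewrite -[RHS]uj0 dot_sum mxE.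
by apply: eq_bigr => i _; rewrite !mxE.
Qed.

(** Turns membership in Im A^T into a linear equation, usable as the constraint of an eigenvector
    problem and as a term of a continuous merit function. *)
Lemma im_trmx_coker m n (A : 'M[R]_(m, n)) (u : 'cV[R]_n) :
  (cokermx A)^T *m u = 0 <-> exists y, u = A^T *m y.
Proof.
split; last first.
  by move=> [y ->]; rewrite mulmxA -trmx_mul mulmx_coker trmx0 mul0mx.
move=> h; have : (u^T <= A)%MS.
  by rewrite submxE -[u^T *m _]trmxK trmx_mul trmxK h trmx0.
by move=> /submxP[D uD]; exists D^T; rewrite -[u]trmxK uD trmx_mul.
Qed.

(* At a maximizer [v0] of [v . B v] on the unit sphere, the nonnegative form
   [mu |v|^2 - v . B v] vanishes, so its gradient does as well. *)
Lemma sym_top_eigenvector p n (B : 'M[R]_n) (C : 'M[R]_(p, n)) (x0 : 'cV[R]_n) :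
  B^T = B -> (forall v : 'cV[R]_n, C *m v = 0 -> C *m (B *m v) = 0) ->
  C *m x0 = 0 -> x0 != 0 ->
  exists v0 : 'cV[R]_n, exists mu : R,
    [/\ C *m v0 = 0, v0 != 0, B *m v0 = mu *: v0
      & forall u, C *m u = 0 -> dot u (B *m u) <= mu * dot u u].
Proof.
move=> Bsym CB Cx0 x0N.
pose S := [set v : 'cV[R]_n | C *m v = 0] `&` [set v | dot v v = 1].
have nrm u : C *m u = 0 -> u != 0 -> S ((enorm u)^-1 *: u).
  move=> Cu uN; split => /=; first by rewrite -scalemxAr Cu scaler0.
  have e0 : enorm u != 0 by apply: contra_neq uN; exact: enorm_eq0.
  by rewrite !dotE -enorm_sqr; field.
pose f (v : 'cV[R]_n) := dot (- v) (B *m v).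
have cf : continuous f.
  apply: continuous_dot; first by apply: coord_contN; exact: coord_cont_id.
  by apply: coord_cont_mulmx; exact: coord_cont_id.
have cS : closed S.
  apply: closedI.
    by apply: closed_coord_eq; apply: coord_cont_mulmx; exact: coord_cont_id.
  rewrite (_ : [set v | _] = [set v | dot v v <= 1] `&` [set v | 1 <= dot v v]).
    apply: closedI; [apply: closed_fun_le|apply: closed_fun_ge];
    by apply: continuous_dot; exact: coord_cont_id.
  rewrite eqEsubset; split => v /=; first by move=> ->; rewrite !lexx.
  by move=> [h1 h2]; apply/eqP; rewrite eq_le h1 h2.
have [v [_ v1] _|v0 [Cv0 v01] vmin] :=
    @closed_argmin _ _ S f _ 1 cS (nrm _ Cx0 x0N) cf.
  by rewrite /enorm v1 sqrtr1.
pose mu := dot v0 (B *m v0).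
have top u : C *m u = 0 -> dot u (B *m u) <= mu * dot u u.
  move=> Cu; have [->|uN] := eqVneq u 0; first by rewrite !dot0l mulr0.
  have := vmin _ (nrm _ Cu uN).
  have e0 : enorm u != 0 by apply: contra_neq uN; exact: enorm_eq0.
  have e1 : 0 < enorm u by rewrite lt_neqAle eq_sym e0 enorm_ge0.
  rewrite /f !dotNl lerN2 -scalemxAr !dotE mulrA -invfM -expr2.
  by rewrite ler_pdivrMl ?exprn_gt0// enorm_sqr mulrC.
exists v0, mu; split => //.
  apply/eqP => v00; move: v01; rewrite v00 /= dot0l => /eqP.
  by rewrite eq_sym oner_eq0.
set g := mu *: v0 - B *m v0.
(* [g] is half the gradient at [v0] of the form [mu |v|^2 - v . B v]; the step [- t g] changes that
   form by [- 2 t |g|^2 + O(t^2)], while it stays nonnegative. *)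
suff : 0 <= - (2 * dot g g).
  move=> g0; apply/eqP; rewrite eq_sym -subr_eq0; apply/eqP/dot_eq0.
  by apply/eqP; rewrite eq_le dot_ge0 andbT; lra.
have Cg : C *m g = 0.
  by rewrite mulmxBr -scalemxAr Cv0 CB// scaler0 subrr.
apply: (@ge0_quad_lin _ (mu * dot g g - dot g (B *m g))) => t _ _.
have := top (v0 - t *: g); rewrite mulmxBr -scalemxAr Cv0 Cg scaler0 subr0.
move=> /(_ erefl); rewrite mulmxBr -scalemxAr.
have gE : dot g g = mu * dot v0 g - dot g (B *m v0).
  by rewrite {1}/g dotDl dotZl dotNl (dotC (B *m v0)).
move: gE Cg => {}gE {}Cg; clearbody g.
have e1 : dot v0 (B *m g) = dot g (B *m v0) by rewrite dotC dot_mulmx Bsym.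
have e2 : dot v0 v0 = 1 by [].
rewrite !dotE -/mu e1 e2 (dotC g v0) => top'.
have -> : t * - (2 * dot g g) = t * - (2 * (mu * dot v0 g - dot g (B *m v0))).
  by rewrite -gE.
lra.
Qed.

End MatrixSpectrum.

Section SingularValues.
Variables (R : realType) (m n : nat) (A : 'M[R]_(m, n)).
Hypothesis hA : A != 0.

Let B := A^T *m A.

Let Bsym : B^T = B. Proof. by rewrite trmx_mul trmxK. Qed.

Let BE u : dot u (B *m u) = enorm (A *m u) ^+ 2.
Proof. by rewrite -mulmxA -dot_mulmx enorm_sqr. Qed.

Lemma pos_singular_valueP s : pos_singular_values A s <->
  0 < s /\ exists2 v : 'cV[R]_n, v != 0 & B *m v = s ^+ 2 *: v.
Proof.
split=> -[s0]; last first.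
  move=> [v vN Bv]; split=> //; apply/eigenvalueP; exists v^T; last first.
    by apply: contra vN => /eqP v0; rewrite -[v]trmxK v0 trmx0.
  by rewrite -[LHS]trmxK trmx_mul trmxK -/B Bsym Bv linearZ.
move=> /eigenvalueP[v Bv vN]; split=> //; exists v^T; last first.
  by rewrite -[LHS]trmxK trmx_mul trmxK Bsym Bv linearZ.
by apply: contra vN => /eqP v0; rewrite -[v]trmxK v0 trmx0.
Qed.

Let sval_norm s (v : 'cV[R]_n) : B *m v = s ^+ 2 *: v ->
  enorm (A *m v) ^+ 2 = s ^+ 2 * enorm v ^+ 2.
Proof. by move=> Bv; rewrite -BE Bv dotZr enorm_sqr. Qed.

Lemma mulmx_neq0_ex : exists x : 'cV[R]_n, A *m x != 0.
Proof.
apply: contrapT => /forallNP H; move/negP: hA; apply; apply/eqP/matrixP => i j.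
have /negP := H (delta_mx j 0); rewrite negbK => /eqP; rewrite -colE => /colP/(_ i).
by rewrite !mxE.
Qed.

(** The constraint matrix has no rows here, so [mu] is the largest eigenvalue of [A^T A] on the
    whole space, and its square root is the greatest element of the set of positive singular
    values. *)
Lemma lambda_max_spec : 0 < lambda_max A /\
  has_sup (pos_singular_values A) /\
  forall x, enorm (A *m x) <= lambda_max A * enorm x.
Proof.
have [x1 Ax1] := mulmx_neq0_ex.
have x1N : x1 != 0 by apply: contra_neq Ax1 => ->; rewrite mulmx0.
have [v0 [mu [_ v0N Bv0 top]]] :=
  @sym_top_eigenvector R 0 n B 0 x1 Bsym
    (fun v _ => mul0mx _ _) (mul0mx _ _) x1N.
have {}top u : enorm (A *m u) ^+ 2 <= mu * enorm u ^+ 2.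
  by rewrite -BE enorm_sqr top// mul0mx.
have pos k (v : 'cV[R]_k) : v != 0 -> 0 < enorm v.
  move=> vN; rewrite lt_neqAle enorm_ge0 andbT eq_sym.
  by apply: contra_neq vN; exact: enorm_eq0.
have mu0 : 0 < mu.
  have := top x1; have := pos _ _ Ax1; have := pos _ _ x1N; nra.
have muS : pos_singular_values A (Num.sqrt mu).
  apply/pos_singular_valueP; split; first by rewrite sqrtr_gt0.
  by exists v0 => //; rewrite sqr_sqrtr// ltW.
have ub : ubound (pos_singular_values A) (Num.sqrt mu).
  move=> s /pos_singular_valueP[s0 [v vN /sval_norm Bv]].
  have := top v; rewrite Bv ler_pM2r ?exprn_gt0 ?pos// => /ler_wsqrtr.
  by rewrite sqrtr_sqr gtr0_norm.
have hs : has_sup (pos_singular_values A).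
  by split; [exists (Num.sqrt mu)|exists (Num.sqrt mu)].
have -> : lambda_max A = Num.sqrt mu.
  apply/eqP; rewrite eq_le; apply/andP; split.
    by apply: ge_sup => //; exists (Num.sqrt mu).
  by apply: ub_le_sup => //; exists (Num.sqrt mu).
split; first by rewrite sqrtr_gt0.
split=> // x; rewrite -(ler_pXn2r (n := 2)) ?nnegrE ?mulr_ge0 ?enorm_ge0 ?sqrtr_ge0//.
by rewrite exprMn (sqr_sqrtr (ltW mu0)) top.
Qed.

(** The top eigenvalue of [- A^T A] restricted to Im A^T is minus the least positive eigenvalue of
    [A^T A]. It is nonzero because Im A^T meets Null A only in 0. *)
Lemma lambda_min_spec : 0 < lambda_min A /\
  (forall y, lambda_min A * enorm (A^T *m y) <= enorm (A *m (A^T *m y))).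
Proof.
have [x1 Ax1] := mulmx_neq0_ex.
have AAx1 : A^T *m (A *m x1) != 0.
  apply: contra_neq Ax1 => h; apply: dot_eq0.
  by rewrite dot_mulmx h dot0r.
pose C := (cokermx A)^T.
have CB (v : 'cV[R]_n) : C *m v = 0 -> C *m (- B *m v) = 0.
  move=> _; apply/im_trmx_coker; exists (- (A *m v)).
  by rewrite mulNmx mulmxN mulmxA.
have Cx : C *m (A^T *m (A *m x1)) = 0 by apply/im_trmx_coker; exists (A *m x1).
have NBsym : (- B)^T = - B by rewrite linearN /= Bsym.
have [v0 [nu [Cv0 v0N Bv0 top]]] := sym_top_eigenvector NBsym CB Cx AAx1.
pose mu := - nu.
have {}Bv0 : B *m v0 = mu *: v0.
  by rewrite /mu scaleNr -Bv0 mulNmx opprK.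
have {}top y : mu * enorm (A^T *m y) ^+ 2 <= enorm (A *m (A^T *m y)) ^+ 2.
  have := top (A^T *m y); rewrite mulNmx dotNr BE -enorm_sqr => h.
  have : C *m (A^T *m y) = 0 by apply/im_trmx_coker; exists y.
  by move/h; rewrite /mu mulNr lerNl.
have pos k (v : 'cV[R]_k) : v != 0 -> 0 < enorm v.
  move=> vN; rewrite lt_neqAle enorm_ge0 andbT eq_sym.
  by apply: contra_neq vN; exact: enorm_eq0.
have mu0 : 0 < mu.
  have e : enorm (A *m v0) ^+ 2 = mu * enorm v0 ^+ 2.
    by rewrite -BE Bv0 dotZr enorm_sqr.
  rewrite ltNge; apply/negP => mu0.
  have Av0 : A *m v0 = 0.
    apply: dot_eq0; rewrite -enorm_sqr; apply/eqP.
    by rewrite eq_le sqr_ge0 andbT e mulr_le0_ge0// sqr_ge0.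
  move/im_trmx_coker: Cv0 => [y v0E].
  move/negP: v0N; apply; apply/eqP/dot_eq0.
  by rewrite {1}v0E dot_mulmx trmxK Av0 dot0r.
have muS : pos_singular_values A (Num.sqrt mu).
  apply/pos_singular_valueP; split; first by rewrite sqrtr_gt0.
  by exists v0 => //; rewrite sqr_sqrtr// ltW.
have lb : lbound (pos_singular_values A) (Num.sqrt mu).
  move=> s /pos_singular_valueP[s0 [v vN Bv]].
  (* An eigenvector for a positive eigenvalue lies in Im A^T, so the restricted extremal bound
     applies to it. *)
  have vE : v = A^T *m ((s ^+ 2)^-1 *: (A *m v)).
    by rewrite -scalemxAr mulmxA -/B Bv scalerA mulVf ?scale1r// expf_neq0// gt_eqF.
  have := top ((s ^+ 2)^-1 *: (A *m v)); rewrite -vE (sval_norm Bv).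
  by rewrite ler_pM2r ?exprn_gt0 ?pos// => /ler_wsqrtr; rewrite sqrtr_sqr gtr0_norm.
have -> : lambda_min A = Num.sqrt mu.
  apply/eqP; rewrite eq_le; apply/andP; split.
    by apply: ge_inf => //; exists (Num.sqrt mu).
  by apply: lb_le_inf => //; exists (Num.sqrt mu).
split; first by rewrite sqrtr_gt0.
move=> y; rewrite -(ler_pXn2r (n := 2)) ?nnegrE ?mulr_ge0 ?enorm_ge0 ?sqrtr_ge0//.
by rewrite exprMn (sqr_sqrtr (ltW mu0)) top.
Qed.

Lemma lambda_max_gt0 : 0 < lambda_max A.
Proof. by case: lambda_max_spec. Qed.

Lemma lambda_min_gt0 : 0 < lambda_min A.
Proof. by case: lambda_min_spec. Qed.

Lemma kappa_gt0 : 0 < kappa A.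
Proof. by rewrite divr_gt0 ?lambda_max_gt0 ?lambda_min_gt0. Qed.

(** [A A^T] and [A^T] have the same kernel, hence [A A^T] and [A] have the same image. *)
Lemma im_mulmx_tr (x : 'cV[R]_n) : exists y, A *m x = A *m (A^T *m y).
Proof.
have [|y Ay] := @im_trmxP R m m (A *m A^T) (A *m x).
  move=> v h; rewrite dot_mulmx.
  have -> : A^T *m v = 0; last by rewrite dot0r.
  by apply: dot_eq0; rewrite dot_mulmx trmxK mulmxA h dot0r.
by exists y; rewrite Ay trmx_mul trmxK mulmxA.
Qed.

End SingularValues.

(** * Moore-Penrose inverse and the PDHG metric *)

Section MoorePenrose.
Variable R : realType.

Lemma mulmx_tr_unit r p (B : 'M[R]_(r, p)) : row_free B -> B *m B^T \in unitmx.
Proof.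
move=> fB; rewrite -row_free_unit -kermx_eq0; apply/eqP/row_matrixP => i.
rewrite row0; set v := row i _.
have : v *m (B *m B^T) = 0 by rewrite /v -row_mul mulmx_ker row0.
rewrite mulmxA => h.
have : (v *m B)^T = 0.
  by apply: dot_eq0; rewrite /dot trmxK trmx_mul mulmxA h mul0mx mxE.
move/(congr1 trmx); rewrite trmxK trmx0 => vB.
by apply: (row_free_inj fB); rewrite vB mul0mx.
Qed.

(** Full-rank factorization: the inverse is the canonical right inverse of [D] times the canonical
    left inverse of [C]. *)
Lemma penrose_factor r k p (C : 'M[R]_(r, k)) (D : 'M[R]_(k, p)) :
  D *m D^T \in unitmx -> C^T *m C \in unitmx ->
  penrose (C *m D)
    (D^T *m invmx (D *m D^T) *m invmx (C^T *m C) *m C^T).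
Proof.
move=> uD uC; set GD := invmx (D *m D^T); set GC := invmx (C^T *m C).
have GDs : GD^T = GD by rewrite trmx_inv trmx_mul trmxK.
have GCs : GC^T = GC by rewrite trmx_inv trmx_mul trmxK.
set X := D^T *m GD *m GC *m C^T.
have BX : C *m D *m X = C *m GC *m C^T.
  by rewrite /X !mulmxA -(mulmxA C D) -(mulmxA C _ GD) mulmxV// mulmx1.
have XB : X *m (C *m D) = D^T *m GD *m D.
  rewrite /X !mulmxA -(mulmxA _ C^T C) -(mulmxA _ GC).
  by rewrite mulVmx// mulmx1.
split.
- by rewrite BX !mulmxA -(mulmxA _ C^T C) -(mulmxA _ GC) mulVmx// mulmx1.
- rewrite XB /X !mulmxA -(mulmxA _ D D^T) -(mulmxA _ (D *m _) GD).
  by rewrite mulmxV// mulmx1.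
- by rewrite BX !trmx_mul trmxK GCs mulmxA.
- by rewrite XB !trmx_mul trmxK GDs mulmxA.
Qed.

Lemma penrose_ex r p (B : 'M[R]_(r, p)) : exists X, penrose B X.
Proof.
have := @penrose_factor _ _ _ (col_base B) (row_base B); rewrite mulmx_base => H.
eexists; apply: H; first by apply: mulmx_tr_unit; exact: row_base_free.
have := @mulmx_tr_unit _ _ (col_base B)^T; rewrite trmxK; apply.
by rewrite /row_free mxrank_tr; exact: col_base_full.
Qed.

Lemma mpinvP r p (B : 'M[R]_(r, p)) : penrose B (mpinv B).
Proof. by have [X hX] := penrose_ex B; exact: (xgetPex 0 (ex_intro _ X hX)). Qed.

Lemma mulmx_q m n (A : 'M[R]_(m, n)) b x : A *m x = b -> A *m Defs.q A b = b.
Proof.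
move=> <-; rewrite /Defs.q; set X := mpinv _.
have [AXA _ _ _] : penrose (A *m A^T) X by exact: mpinvP.
suff : A *m A^T *m X *m A = A by rewrite !mulmxA => ->.
(* [E = (A A^T X - 1) A] satisfies [E A^T = 0] by the first Penrose equation, hence [E E^T = 0] and
   each row of [E] vanishes. *)
apply/eqP; rewrite -subr_eq0; set E := _ - _.
have EA : E *m A^T = 0.
  rewrite mulmxBl; apply/eqP; rewrite subr_eq0; apply/eqP.
  by rewrite -[in RHS]AXA !mulmxA.
apply/eqP/row_matrixP => i; rewrite row0 -[LHS]trmxK -[RHS]trmxK; congr (_^T).
rewrite trmx0; apply: dot_eq0; rewrite /dot trmxK tr_row.
have -> : row i E *m col i E^T = row i E *m (E^T *m delta_mx i 0) by rewrite -colE.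
have -> : E^T = A^T *m (A *m A^T *m X - 1%:M)^T.
  by rewrite -trmx_mul mulmxBl mul1mx.
by rewrite !mulmxA -row_mul EA row0 !mul0mx mxE.
Qed.

Lemma q_im m n (A : 'M[R]_(m, n)) b : exists y, Defs.q A b = A^T *m y.
Proof. by exists (mpinv (A *m A^T) *m b); rewrite mulmxA. Qed.

End MoorePenrose.

Section SpectralBounds.
Variables (R : realType) (m n : nat) (A : 'M[R]_(m, n)).
Hypothesis hA : A != 0.

Let lmin0 := lambda_min_gt0 hA.
Let lmax0 := lambda_max_gt0 hA.

Lemma tr_mulmx_neq0_ex : exists y : 'cV[R]_m, A^T *m y != 0.
Proof.
apply: mulmx_neq0_ex; apply: contra hA => /eqP h.
by rewrite -[A]trmxK h trmx0.
Qed.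

Lemma lambda_min_le_max : lambda_min A <= lambda_max A.
Proof.
have [y yN] := tr_mulmx_neq0_ex.
have [_ lo] := lambda_min_spec hA; have [_ [_ up]] := lambda_max_spec hA.
have := le_trans (lo y) (up _); rewrite ler_pM2r// lt_neqAle enorm_ge0 andbT eq_sym.
by apply: contra_neq yN; exact: enorm_eq0.
Qed.

Lemma kappa_ge1 : 1 <= kappa A.
Proof. by rewrite ler_pdivlMr// mul1r lambda_min_le_max. Qed.

(** The same lower bound for [A^T] on Im A: write the image as [A u] with [u] in Im A^T, and combine
    [|A u|^2 <= |u| |A^T A u|] with [lambda_min |u| <= |A u|]. *)
Lemma lambda_min_im (x : 'cV[R]_n) :
  lambda_min A * enorm (A *m x) <= enorm (A^T *m (A *m x)).
Proof.
have [y ->] := im_mulmx_tr A x; set u := A^T *m y.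
have [_ /(_ y)] := lambda_min_spec hA; rewrite -/u => lo.
have h1 : enorm (A *m u) ^+ 2 <= enorm u * enorm (A^T *m (A *m u)).
  by rewrite enorm_sqr dot_mulmx; exact: dot_le_enorm.
have [->|N] := eqVneq (enorm (A *m u)) 0; first by rewrite mulr0 enorm_ge0.
have P : 0 < enorm (A *m u) by rewrite lt_neqAle eq_sym N enorm_ge0.
rewrite -(ler_pM2r P) -mulrA -expr2.
have := enorm_ge0 (A^T *m (A *m u)); have := enorm_ge0 u.
move: (enorm (A^T *m (A *m u))) (enorm (A *m u)) (enorm u) lo h1 P => a d e.
move=> lo h1 P e0 a0.
have : lambda_min A * d ^+ 2 <= lambda_min A * (e * a) by rewrite ler_pM2l.
have := ler_wpM2r a0 lo; lra.
Qed.

(** The correction is taken in Im A^T, where [A] expands lengths by at least [lambda_min]. *)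
Lemma near_affine (x x1 : 'cV[R]_n) : exists2 xh, A *m xh = A *m x1 &
  lambda_min A * enorm (x - xh) <= enorm (A *m x1 - A *m x).
Proof.
have [y hy] := im_mulmx_tr A (x1 - x).
exists (x + A^T *m y); first by rewrite mulmxDr -hy mulmxBr addrC subrK.
rewrite opprD addrA subrr add0r enormN -mulmxBr hy.
by case: (lambda_min_spec hA).
Qed.

End SpectralBounds.

Section PDHGMetric.
Variables (R : realType) (m n : nat) (A : 'M[R]_(m, n)) (tau sigma : R).

Local Notation M := (Mpdhg A tau sigma).

Lemma Mpdhg_sym : M^T = M.
Proof. by rewrite tr_block_mx !tr_scalar_mx trmxK. Qed.

Lemma Mpdhg_form (z w : 'cV[R]_(n + m)) : dot z (M *m w) =
  tau^-1 * dot (usubmx z) (usubmx w) + dot (usubmx z) (A^T *m dsubmx w) +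
  dot (dsubmx z) (A *m usubmx w) + sigma^-1 * dot (dsubmx z) (dsubmx w).
Proof.
rewrite -{1}[z]vsubmxK -{1}[w]vsubmxK mul_block_col dot_col_mx !mul_scalar_mx.
by rewrite !dotDr !dotZr !addrA.
Qed.

End PDHGMetric.

Section PDHGMetricScaled.
Variables (R : realType) (m n : nat) (A : 'M[R]_(m, n)).
Hypothesis hA : A != 0.

Local Notation tau := (kappa A)^-1.
Local Notation sigma := (lambda_max A * lambda_min A)^-1.
Local Notation M := (Mpdhg A tau sigma).
Local Notation "'Mn' z" := (Mnorm A tau sigma z) (at level 10, z at level 9).

Let lmin0 := lambda_min_gt0 hA.
Let lmax0 := lambda_max_gt0 hA.
Let k0 := kappa_gt0 hA.

Lemma kappa_lmin : kappa A * lambda_min A = lambda_max A.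
Proof. by rewrite divfK// gt_eqF. Qed.

(* Here tau sigma lambda_max^2 = 1, so the form is only semidefinite. *)
Lemma Mpdhg_scaled_form (z : 'cV[R]_(n + m)) : dot z (M *m z) =
  kappa A * (enorm (usubmx z) ^+ 2 + (lambda_min A * enorm (dsubmx z)) ^+ 2)
  + 2 * dot (dsubmx z) (A *m usubmx z).
Proof.
rewrite Mpdhg_form !invrK -dot_mulmx (dotC (A *m _)) !enorm_sqr exprMn.
rewrite -kappa_lmin enorm_sqr; ring.
Qed.

Lemma dot_mulmx_bound (x : 'cV[R]_n) (y : 'cV[R]_m) :
  `|dot y (A *m x)| <= kappa A * (enorm x * (lambda_min A * enorm y)).
Proof.
have [_ [_ up]] := lambda_max_spec hA.
have h : enorm y * enorm (A *m x) <= kappa A * (enorm x * (lambda_min A * enorm y)).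
  have -> : kappa A * (enorm x * (lambda_min A * enorm y)) =
     enorm y * ((kappa A * lambda_min A) * enorm x) by ring.
  by rewrite kappa_lmin ler_wpM2l ?enorm_ge0.
rewrite ler_norml -lerNl.
by rewrite (le_trans (dotN_le_enorm _ _) h) (le_trans (dot_le_enorm _ _) h).
Qed.

(** By the bound on the cross term, the form dominates [kappa (|x| - lambda_min |y|)^2]. *)
Lemma Mpdhg_psd (z : 'cV[R]_(n + m)) : 0 <= dot z (M *m z).
Proof.
rewrite Mpdhg_scaled_form.
have := dot_mulmx_bound (usubmx z) (dsubmx z); rewrite ler_norml => /andP[h _].
have : 0 <= kappa A * (enorm (usubmx z) - lambda_min A * enorm (dsubmx z)) ^+ 2.
  by rewrite mulr_ge0 ?sqr_ge0// ltW.
lra.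
Qed.

Lemma MnormE (z : 'cV[R]_(n + m)) : Mn z = seminorm M z.
Proof. by []. Qed.

Lemma Mnorm_ge0 (z : 'cV[R]_(n + m)) : 0 <= Mn z.
Proof. exact: sqrtr_ge0. Qed.

Lemma Mnorm_sqr (z : 'cV[R]_(n + m)) : Mn z ^+ 2 = dot z (M *m z).
Proof. by rewrite sqr_sqrtr// Mpdhg_psd. Qed.

Lemma Mnorm_x (u : 'cV[R]_n) : Mn (col_mx u 0) = Num.sqrt (kappa A) * enorm u.
Proof.
rewrite /Mnorm Mpdhg_scaled_form col_mxKu col_mxKd enorm0 dot0l !mulr0 addr0.
by rewrite expr0n addr0 sqrtrM ?(ltW k0)// sqrtr_sqr ger0_norm// enorm_ge0.
Qed.

Lemma Mnorm_y (v : 'cV[R]_m) :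
  Mn (col_mx 0 v) = Num.sqrt (kappa A) * lambda_min A * enorm v.
Proof.
rewrite /Mnorm Mpdhg_scaled_form col_mxKu col_mxKd enorm0 mulmx0 dot0r mulr0 addr0.
rewrite expr0n add0r sqrtrM ?(ltW k0)// sqrtr_sqr ger0_norm ?mulrA//.
by rewrite mulr_ge0 ?enorm_ge0// ltW.
Qed.

(** With y in Im A one has [lambda_min |y| <= |A^T y|], so the length of the dual slack controls the
    y-part; the factor [sqrt 2] is [(a + e)^2 <= 2 (a^2 + e^2)]. *)
Lemma Mnorm_le (z : 'cV[R]_(n + m)) (v : 'cV[R]_n) : dsubmx z = A *m v ->
  Mn z <= Num.sqrt 2 * Num.sqrt (kappa A) *
          enorm (col_mx (usubmx z) (A^T *m dsubmx z)).
Proof.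
move=> zv; set w := col_mx _ _.
have s0 : 0 <= Num.sqrt 2 * Num.sqrt (kappa A) by rewrite mulr_ge0 ?sqrtr_ge0.
rewrite -(ler_pXn2r (n := 2)) ?nnegrE ?mulr_ge0 ?enorm_ge0 ?Mnorm_ge0 ?sqrtr_ge0//.
rewrite !exprMn (sqr_sqrtr (ler0n _ 2)) (sqr_sqrtr (ltW k0)).
rewrite Mnorm_sqr Mpdhg_scaled_form enorm_col_mx_sqr.
have := dot_mulmx_bound (usubmx z) (dsubmx z); rewrite ler_norml => /andP[_ h].
have h1 : lambda_min A * enorm (dsubmx z) <= enorm (A^T *m dsubmx z).
  by rewrite zv lambda_min_im.
have h2 : 0 <= lambda_min A * enorm (dsubmx z).
  by rewrite mulr_ge0 ?enorm_ge0// ltW.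
have := enorm_ge0 (usubmx z).
move: h h1 h2; move: (enorm (usubmx z)) (lambda_min A * _) (enorm (A^T *m _)).
move=> a e f h h1 h2 a0.
have k1 : 0 <= kappa A * (a - e) ^+ 2 by rewrite mulr_ge0 ?sqr_ge0// ltW.
have k2 : kappa A * e ^+ 2 <= kappa A * f ^+ 2.
  by rewrite ler_pM2l// ler_pXn2r ?nnegrE// (le_trans h2).
lra.
Qed.

Lemma MnormZ t (u : 'cV[R]_(n + m)) : Mn (t *: u) = `|t| * Mn u.
Proof. exact: seminormZ. Qed.

Lemma MnormB (u v : 'cV[R]_(n + m)) : Mn (u - v) = Mn (v - u).
Proof. exact: seminormB. Qed.

Lemma Mnorm_dist (u v w : 'cV[R]_(n + m)) : Mn (u - w) <= Mn (u - v) + Mn (v - w).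
Proof. exact: (seminorm_dist (Mpdhg_sym _ _ _) Mpdhg_psd). Qed.

End PDHGMetricScaled.

(** * PDHG steps and their averages *)

Section LagrangianGap.
Variables (R : realType) (m n : nat) (A : 'M[R]_(m, n)) (b : 'cV[R]_m) (c : 'cV[R]_n).

(** The bracket under the supremum in [rho], as opposed to the objective gap [Gap]. *)
Definition pdgap (z zh : 'cV[R]_(n + m)) : R :=
  Lagrangian A b c (usubmx z) (dsubmx zh) - Lagrangian A b c (usubmx zh) (dsubmx z).

Lemma pdgapE z zh : pdgap z zh =
  dot (b - A *m usubmx z) (dsubmx zh - dsubmx z)
  - dot (c - A^T *m dsubmx z) (usubmx zh - usubmx z).
Proof.
rewrite /pdgap /Lagrangian !dotE -!dot_mulmx !(dotC (A^T *m _)) -!dot_mulmx; ring.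
Qed.

(** In this form the gap is visibly affine in [z], so the gap of an average is the average of the
    gaps. *)
Lemma pdgap_affine z zh : pdgap z zh =
  dot (col_mx (c - A^T *m dsubmx zh) (A *m usubmx zh - b)) z
  + (dot b (dsubmx zh) - dot c (usubmx zh)).
Proof.
rewrite dot_split col_mxKu col_mxKd /pdgap /Lagrangian !dotE.
rewrite !(dotC (A^T *m _)) -!dot_mulmx; ring.
Qed.

Lemma pdgapZ z zh t : pdgap z (z + t *: (zh - z)) = t * pdgap z zh.
Proof.
rewrite !pdgapE.
have -> : dsubmx (z + t *: (zh - z)) - dsubmx z = t *: (dsubmx zh - dsubmx z).
  by apply/colP => i; rewrite !mxE; ring.
have -> : usubmx (z + t *: (zh - z)) - usubmx z = t *: (usubmx zh - usubmx z).
  by apply/colP => i; rewrite !mxE; ring.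
by rewrite !dotZr; ring.
Qed.

End LagrangianGap.

Section PDHGIteration.
Variables (R : realType) (m n : nat) (Kp : set 'cV[R]_n).
Variables (A : 'M[R]_(m, n)) (b : 'cV[R]_m) (c : 'cV[R]_n).
Hypothesis hK : closed_convex_cone Kp.

Lemma OnePDHG_cone tau sigma z : Kp (usubmx (OnePDHG Kp A b c tau sigma z)).
Proof. by rewrite col_mxKu; exact: proj_in. Qed.

(** Add the variational inequality of the projection, divided by [tau], to the update of y solved
    for [b - A x']. The extrapolation [2 x' - x] is what makes the cross terms assemble into the
    symmetric matrix M. *)
Lemma OnePDHG_gap tau sigma z zh : 0 < tau -> 0 < sigma -> Kp (usubmx zh) ->
  let z' := OnePDHG Kp A b c tau sigma z in
  pdgap A b c z' zh <= dot (zh - z') (Mpdhg A tau sigma *m (z' - z)).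
Proof.
move=> t0 s0 Kzh; cbv zeta; set z' := OnePDHG _ _ _ _ _ _ _.
rewrite pdgapE Mpdhg_form.
have zu : usubmx z' = Defs.proj Kp (usubmx z - tau *: (c - A^T *m dsubmx z)).
  by rewrite col_mxKu.
have zd : dsubmx z' = dsubmx z + sigma *: (b - A *m (2 *: usubmx z' - usubmx z)).
  by rewrite zu col_mxKd.
have := proj_le0 hK (usubmx z - tau *: (c - A^T *m dsubmx z)) Kzh.
rewrite -zu.
have hy : b - A *m usubmx z' =
    sigma^-1 *: (dsubmx z' - dsubmx z) + A *m (usubmx z' - usubmx z).
  rewrite zd addrAC subrr add0r scalerA mulVf ?gt_eqF// scale1r.
  rewrite !mulmxBr -scalemxAr scaler_nat mulr2n.
  by apply/colP => i; rewrite !mxE; ring.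
have sB : forall k l (u v : 'cV[R]_(k + l)), usubmx (u - v) = usubmx u - usubmx v.
  by move=> *; rewrite linearB.
have dB : forall k l (u v : 'cV[R]_(k + l)), dsubmx (u - v) = dsubmx u - dsubmx v.
  by move=> *; rewrite linearB.
rewrite !sB !dB hy; clear hy zd zu sB dB.
move: (usubmx z) (usubmx z') (dsubmx z) (dsubmx z') (usubmx zh) (dsubmx zh).
clear z z' zh Kzh.
move=> x x' y y' xh yh H.
have {H} : tau^-1 * dot (x - tau *: (c - A^T *m y) - x') (xh - x') <= 0.
  by rewrite pmulr_rle0// invr_gt0.
have -> : tau^-1 * dot (x - tau *: (c - A^T *m y) - x') (xh - x') =
   tau^-1 * dot (x - x') (xh - x') - dot (c - A^T *m y) (xh - x').
  by rewrite !dotE; field; rewrite gt_eqF.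
rewrite -!dot_mulmx !mulmxBr !dotE.
rewrite !(dotC (A^T *m _)) -!dot_mulmx !(dotC _ x') !(dotC _ xh) !(dotC _ y') !(dotC _ yh).
lra.
Qed.

Lemma dot_sumr k (u : 'cV[R]_k) I (r : seq I) (F : I -> 'cV[R]_k) :
  dot u (\sum_(i <- r) F i) = \sum_(i <- r) dot u (F i).
Proof.
elim/big_rec2: _ => [|i y x _ <-]; first by rewrite dot0r.
by rewrite dotDr.
Qed.

Hypothesis hA : A != 0.

Local Notation tau := (kappa A)^-1.
Local Notation sigma := (lambda_max A * lambda_min A)^-1.
Local Notation M := (Mpdhg A tau sigma).
Local Notation "'Mn' z" := (Mnorm A tau sigma z) (at level 10, z at level 9).
Local Notation step := (OnePDHG Kp A b c tau sigma).
Local Notation avg := (pdhg_avg Kp A b c tau sigma).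
Local Notation gap := (pdgap A b c).

Lemma tau_gt0 : 0 < tau.
Proof. by rewrite invr_gt0 kappa_gt0. Qed.

Lemma sigma_gt0 : 0 < sigma.
Proof. by rewrite invr_gt0 mulr_gt0 ?lambda_max_gt0 ?lambda_min_gt0. Qed.

(** Polarization of the previous bound; the discarded term is the square of the M-length of the
    step. *)
Lemma step_gap z zh : Kp (usubmx zh) ->
  2 * gap (step z) zh <= Mn (zh - z) ^+ 2 - Mn (zh - step z) ^+ 2.
Proof.
move=> Kzh; have := OnePDHG_gap z tau_gt0 sigma_gt0 Kzh; cbv zeta.
set z' := step z; clearbody z' => h.
have := Mpdhg_psd hA (z' - z).
have -> : zh - z = (zh - z') + (z' - z) by rewrite subrKA.
move: h; rewrite !(Mnorm_sqr hA); move: (zh - z') (z' - z) => u v h.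
rewrite (mulmxDr M) !dotE (bilin_sym (Mpdhg_sym _ _ _) v u); lra.
Qed.

Lemma iter_gap z zh k : Kp (usubmx zh) ->
  2 * (\sum_(1 <= i < k.+1) gap (iter i step z) zh) <=
  Mn (zh - z) ^+ 2 - Mn (zh - iter k step z) ^+ 2.
Proof.
move=> Kzh; elim: k => [|k IH]; first by rewrite big_geq// mulr0 /= subrr.
rewrite big_nat_recr//= mulrDr.
have := step_gap (iter k step z) Kzh; lra.
Qed.

Lemma avg_sum z k (w : 'cV[R]_(n + m)) : (0 < k)%N ->
  dot w (avg z k) = k%:R^-1 * \sum_(1 <= i < k.+1) dot w (iter i step z).
Proof. by move=> k0; rewrite /pdhg_avg dotZr dot_sumr. Qed.

(** The telescoped sum [iter_gap], read at the average because the gap is affine in its first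
    argument. *)
Lemma avg_gap z zh k : (0 < k)%N -> Kp (usubmx zh) ->
  2 * k%:R * gap (avg z k) zh <= Mn (zh - z) ^+ 2.
Proof.
move=> k0 Kzh; have := iter_gap z k Kzh.
have kN : k%:R != 0 :> R by rewrite pnatr_eq0 -lt0n.
suff -> : \sum_(1 <= i < k.+1) gap (iter i step z) zh = k%:R * gap (avg z k) zh.
  by move=> h; have := sqr_ge0 (Mn (zh - iter k step z)); lra.
rewrite pdgap_affine avg_sum// mulrDr mulVKf//.
under eq_bigr do rewrite pdgap_affine.
by rewrite big_split/= sumr_const_nat subn1 /= mulr_natl.
Qed.

Lemma avg_cone z k : (0 < k)%N -> Kp (usubmx (avg z k)).
Proof.
move=> k0; rewrite /pdhg_avg linearZ linear_sum /=.
apply: (coneZ hK); first by rewrite invr_ge0 ler0n.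
rewrite big_add1 /=; apply: (cone_sum hK) => i _.
exact: OnePDHG_cone.
Qed.

Lemma iter_im z k : (exists x, b = A *m x) -> (exists v, dsubmx z = A *m v) ->
  exists v, dsubmx (iter k step z) = A *m v.
Proof.
move=> [x bx] hz; elim: k => [//|k [v hv]]; rewrite iterS col_mxKd hv bx.
set u := 2 *: _ - _; clearbody u; exists (v + sigma *: (x - u)).
by rewrite mulmxDr -scalemxAr mulmxBr.
Qed.

Lemma avg_im z k : (exists x, b = A *m x) -> (exists v, dsubmx z = A *m v) ->
  exists v, dsubmx (avg z k) = A *m v.
Proof.
move=> hb hz; rewrite /pdhg_avg linearZ linear_sum /=.
suff [v ->] : exists v, \sum_(1 <= i < k.+1) dsubmx (iter i step z) = A *m v.
  by exists (k%:R^-1 *: v); rewrite scalemxAr.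
elim/big_ind: _ => [|x y [v ->] [w ->]|i _]; first by exists 0; rewrite mulmx0.
  by exists (v + w); rewrite mulmxDr.
exact: iter_im.
Qed.

(* Primal-dual optimal pairs (x, y), normalized by y in Im A. *)
Definition saddle (zs : 'cV[R]_(n + m)) : Prop :=
  [/\ Kp (usubmx zs), A *m usubmx zs = b, dual_cone Kp (c - A^T *m dsubmx zs),
      dot c (usubmx zs) = dot b (dsubmx zs) & exists v, dsubmx zs = A *m v].

(** Feasibility and equal objectives reduce the gap to the product of x with the optimal slack. *)
Lemma saddle_gap_ge0 z zs : saddle zs -> Kp (usubmx z) -> 0 <= gap z zs.
Proof.
move=> [Kx Ax Ks e _] Kz; rewrite /pdgap /Lagrangian -!dot_mulmx Ax.
have := Ks _ Kz; rewrite !dotE e -dot_mulmx (dotC _ c); lra.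
Qed.

Lemma step_fejer z zs : saddle zs -> Mn (zs - step z) <= Mn (zs - z).
Proof.
move=> hs; have [Kx _ _ _ _] := hs.
have := step_gap z Kx; have := saddle_gap_ge0 hs (OnePDHG_cone tau sigma z).
move=> h1 h2; rewrite -(ler_pXn2r (n := 2)) ?nnegrE ?Mnorm_ge0//; lra.
Qed.

Lemma avg_fejer z zs k : (0 < k)%N -> saddle zs -> Mn (zs - avg z k) <= Mn (zs - z).
Proof.
move=> k0 hs; have kN : k%:R != 0 :> R by rewrite pnatr_eq0 -lt0n.
have it i : Mn (zs - iter i step z) <= Mn (zs - z).
  by elim: i => // i IH; rewrite iterS (le_trans (step_fejer _ hs)).
have -> : zs - avg z k = k%:R^-1 *: \sum_(1 <= i < k.+1) (zs - iter i step z).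
  rewrite sumrB sumr_const_nat subn1 /= scalerBr -(scaler_nat k zs) scalerA mulVf//.
  by rewrite scale1r.
rewrite MnormZ ger0_norm ?invr_ge0// ler_pdivrMl ?ltr0n//.
apply: le_trans (seminorm_sum (Mpdhg_sym _ _ _) (Mpdhg_psd hA) _ _ _) _.
apply: le_trans (ler_sum _ (fun i _ => it i)) _.
by rewrite sumr_const_nat subn1 /= mulr_natl.
Qed.

Lemma avg_move z zs k : (0 < k)%N -> saddle zs -> Mn (avg z k - z) <= 2 * Mn (zs - z).
Proof.
move=> k0 hs; have := Mnorm_dist hA (avg z k) zs z.
rewrite (MnormB _ (avg z k) zs); have := avg_fejer z k0 hs; lra.
Qed.

End PDHGIteration.

(** * The normalized duality gap *)

Section NormalizedGap.
Variables (R : realType) (m n : nat) (Kp : set 'cV[R]_n).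
Variables (A : 'M[R]_(m, n)) (b : 'cV[R]_m) (c : 'cV[R]_n).
Hypothesis hK : closed_convex_cone Kp.
Hypothesis hA : A != 0.

Local Notation tau := (kappa A)^-1.
Local Notation sigma := (lambda_max A * lambda_min A)^-1.
Local Notation "'Mn' z" := (Mnorm A tau sigma z) (at level 10, z at level 9).
Local Notation avg := (pdhg_avg Kp A b c tau sigma).
Local Notation gap := (pdgap A b c).
Local Notation rho := (Defs.rho Kp A b c tau sigma).
Implicit Types (z zh : 'cV[R]_(n + m)) (r P : R).

Lemma rho_ge0 r z : 0 <= r -> Kp (usubmx z) -> (0 <= rho r z)%E.
Proof.
move=> r0 Kz; apply: mule_ge0; first by rewrite lee_fin invr_ge0.
apply: ereal_sup_ubound; exists z; last by rewrite subrr.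
by split=> //; rewrite subrr MnormE (seminorm0 _).
Qed.

Lemma rho_le r z C : 0 <= r ->
  (forall zh, Kp (usubmx zh) -> Mn (zh - z) <= r -> gap z zh <= C) ->
  (rho r z <= (r^-1 * C)%:E)%E.
Proof.
move=> r0 H; rewrite EFinM; apply: lee_wpmul2l; first by rewrite lee_fin invr_ge0.
by apply: ge_ereal_sup => _ [zh [Kzh dzh] <-]; rewrite lee_fin; exact: H.
Qed.

Lemma rho_ge r z P zh : 0 < r -> (rho r z <= P%:E)%E ->
  Kp (usubmx zh) -> Mn (zh - z) <= r -> gap z zh <= r * P.
Proof.
move=> r0 H Kzh dzh; rewrite -ler_pdivrMl// -lee_fin EFinM; apply: le_trans H.
apply: lee_wpmul2l; first by rewrite lee_fin invr_ge0 ltW.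
by apply: ereal_sup_ubound; exists zh.
Qed.

(** A point within [r] of the average is within [2 r] of [z], so its gap is at most
    [(2 r)^2 / (2 k)]; then divide by [r]. *)
Lemma avg_rho_le z k : (0 < k)%N ->
  (rho (Mn (avg z k - z)) (avg z k) <= (2 * Mn (avg z k - z) / k%:R)%:E)%E.
Proof.
move=> k0; set r := Mn (avg z k - z).
have r0 : 0 <= r by exact: Mnorm_ge0.
have kP : 0 < k%:R :> R by rewrite ltr0n.
have -> : 2 * r / k%:R = r^-1 * (2 * r ^+ 2 / k%:R).
  (* For [r = 0] both sides vanish, by the convention [0^-1 = 0]. *)
  have [->|rN] := eqVneq r 0; first by rewrite mulr0 mul0r expr0n mulr0 mul0r mulr0.
  by field; rewrite rN gt_eqF.
apply: rho_le => // zh Kzh dzh.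
have := avg_gap b c hK hA z k0 Kzh.
have h : Mn (zh - z) <= 2 * r.
  have := Mnorm_dist hA zh (avg z k) z; rewrite -/r; lra.
have : Mn (zh - z) ^+ 2 <= (2 * r) ^+ 2.
  by rewrite ler_pXn2r ?nnegrE ?Mnorm_ge0// (le_trans _ h)// Mnorm_ge0.
move=> h2 h3; rewrite ler_pdivlMr//; lra.
Qed.

(** Finiteness, although a singular M may leave the feasible set of the supremum unbounded. *)
Lemma avg_rho_fin z k : (0 < k)%N -> exists P, [/\ 0 <= P,
  rho (Mn (avg z k - z)) (avg z k) = P%:E & P <= 2 * Mn (avg z k - z) / k%:R].
Proof.
move=> k0; have := avg_rho_le z k0.
have := rho_ge0 (Mnorm_ge0 A (avg z k - z)) (avg_cone A b c hK z k0).
case: (rho _ _) => [P| |//]; last by rewrite leye_eq.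
by rewrite !lee_fin => P0 P1; exists P; split.
Qed.

(* The degenerate case [r = 0], where [rho] is [0] by convention, still makes
   the average a saddle point: the gap is linear along segments but bounded by
   a quadratic. *)
Lemma avg_control z k P zh : (0 < k)%N ->
  rho (Mn (avg z k - z)) (avg z k) = P%:E -> Kp (usubmx zh) ->
  gap (avg z k) zh <= P * Num.max (Mn (avg z k - z)) (Mn (zh - avg z k)).
Proof.
move=> k0 rP Kzh; set zb := avg z k in rP *; set r := Mn (zb - z) in rP *.
have Kzb : Kp (usubmx zb) by exact: avg_cone.
have r0 : 0 <= r by exact: Mnorm_ge0.
have P0 : 0 <= P by have := rho_ge0 r0 Kzb; rewrite rP lee_fin.
have d0 := Mnorm_ge0 A (zh - zb).
have segm t : 0 <= t -> t <= 1 -> Kp (usubmx (zb + t *: (zh - zb))).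
  move=> t0 t1.
  have -> : usubmx (zb + t *: (zh - zb)) = (1 - t) *: usubmx zb + t *: usubmx zh.
    by apply/colP => i; rewrite !mxE; ring.
  by apply: coneD => //; apply: coneZ => //; rewrite subr_ge0.
have segd t : 0 <= t -> Mn (zb + t *: (zh - zb) - zb) = t * Mn (zh - zb).
  by move=> t0; rewrite addrAC subrr add0r MnormZ ger0_norm.
move: r0; rewrite le_eqVlt => /predU1P[r0|r0].
  suff : gap zb zh <= 0.
    by move/le_trans; apply; rewrite mulr_ge0// le_max d0 orbT.
  suff : 0 <= - (2 * k%:R * gap zb zh).
    by rewrite oppr_ge0 pmulr_rle0// mulr_gt0 ?ltr0n.
  apply: (@ge0_quad_lin _ (Mn (zh - zb) ^+ 2)) => t t0 t1.
  have := avg_gap b c hK hA z k0 (segm t (ltW t0) t1); rewrite -/zb pdgapZ.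
  have : Mn (zb + t *: (zh - zb) - z) <= t * Mn (zh - zb).
    have e0 : Mn (zb - z) = 0 by rewrite -[LHS]/r.
    have := Mnorm_dist hA (zb + t *: (zh - zb)) zb z.
    by rewrite e0 addr0 (segd _ (ltW t0)).
  rewrite -(ler_pXn2r (n := 2)) ?nnegrE ?Mnorm_ge0 ?mulr_ge0 ?(ltW t0)//.
  rewrite exprMn; lra.
have rP' : (rho r zb <= P%:E)%E by rewrite rP.
have [dr|dr] := leP (Mn (zh - zb)) r.
  by have := rho_ge r0 rP' Kzh dr; rewrite mulrC.
have dp : 0 < Mn (zh - zb) by exact: lt_trans r0 dr.
(* Beyond radius [r], the bound is used at the point of the segment at M-distance exactly [r] and
   extended by linearity of the gap. *)
have t0 : 0 <= r / Mn (zh - zb) by rewrite divr_ge0// ltW.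
have t1 : r / Mn (zh - zb) <= 1 by rewrite ler_pdivrMr// mul1r ltW.
have := rho_ge r0 rP' (segm _ t0 t1); rewrite segd// divfK ?gt_eqF// lexx.
move=> /(_ isT); rewrite pdgapZ mulrAC ler_pdivrMr// -mulrA ler_pM2l//.
Qed.

(* What a bound on the normalized gap says about [z]: take zh - z along
   (0, b - A x), along (proj Kp (- s), 0), and zh = 0. *)
Section Residuals.
Variables (z : 'cV[R]_(n + m)) (r P : R).
Hypothesis hP : 0 <= P.
Hypothesis hz : forall zh, Kp (usubmx zh) ->
  gap z zh <= P * Num.max r (Mn (zh - z)).
Hypothesis Kz : Kp (usubmx z).

(** Along a ray the step can be taken so long that [r] no longer counts in the maximum; both sides
    are then linear in the step. *)
Let direction_bound d : (forall t, 0 <= t -> Kp (usubmx (z + t *: d))) ->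
  0 < Mn d ->
  dot (b - A *m usubmx z) (dsubmx d) - dot (c - A^T *m dsubmx z) (usubmx d)
  <= P * Mn d.
Proof.
move=> Kd d0.
pose t := Num.max 1 (r / Mn d).
have t0 : 0 < t by rewrite lt_max ltr01.
have tr : r <= t * Mn d by rewrite -ler_pdivrMr// le_max lexx orbT.
have := hz (Kd t (ltW t0)); rewrite addrAC subrr add0r MnormZ gtr0_norm//.
rewrite max_r// pdgapE.
have -> : dsubmx (z + t *: d) - dsubmx z = t *: dsubmx d.
  by apply/colP => i; rewrite !mxE; ring.
have -> : usubmx (z + t *: d) - usubmx z = t *: usubmx d.
  by apply/colP => i; rewrite !mxE; ring.
by rewrite !dotZr -mulrBr mulrCA ler_pM2l.
Qed.

Lemma primal_residual :
  enorm (b - A *m usubmx z) <= Num.sqrt (kappa A) * P * lambda_min A.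
Proof.
set v := b - _.
have [->|vN] := eqVneq (enorm v) 0.
  by rewrite !mulr_ge0 ?sqrtr_ge0// ltW// lambda_min_gt0.
have v0 : 0 < enorm v by rewrite lt_neqAle eq_sym vN enorm_ge0.
have := @direction_bound (col_mx 0 v); rewrite Mnorm_y// col_mxKu col_mxKd -/v.
rewrite dot0r subr0 -enorm_sqr expr2 => H.
rewrite -(ler_pM2r v0).
have -> : Num.sqrt (kappa A) * P * lambda_min A * enorm v =
  P * (Num.sqrt (kappa A) * lambda_min A * enorm v) by ring.
apply: H.
- by move=> t _; rewrite linearD linearZ /= col_mxKu scaler0 addr0.
- by apply: mulr_gt0 v0; rewrite mulr_gt0 ?sqrtr_gt0 ?lambda_min_gt0 ?(kappa_gt0 hA).
Qed.

Lemma dual_residual : exists2 p, dual_cone Kp (c - A^T *m dsubmx z + p) &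
  enorm p <= Num.sqrt (kappa A) * P.
Proof.
(* Moreau at [- s]: the vector [s + p] is dual feasible and [s . p = - |p|^2], so [p] is a direction
   in the cone that exposes the dual infeasibility. *)
set s := c - _; have [Ks ps] := proj_moreau hK (- s).
have Kpp := proj_in hK (- s).
set p := Defs.proj Kp (- s) in Ks ps Kpp; rewrite opprK addrC in Ks ps.
exists p => //.
have [->|pN] := eqVneq (enorm p) 0; first by rewrite mulr_ge0 ?sqrtr_ge0.
have p0 : 0 < enorm p by rewrite lt_neqAle eq_sym pN enorm_ge0.
have := @direction_bound (col_mx p 0); rewrite Mnorm_x// col_mxKu col_mxKd -/s.
have -> : dot s p = - enorm p ^+ 2.
  by move: ps; rewrite enorm_sqr dotDr (dotC p s); lra.
rewrite dot0r sub0r opprK expr2 => H.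
rewrite -(ler_pM2r p0).
have -> : Num.sqrt (kappa A) * P * enorm p = P * (Num.sqrt (kappa A) * enorm p).
  by ring.
apply: H.
- move=> t t0; rewrite linearD linearZ /= col_mxKu.
  by apply: (coneD hK) => //; apply: (coneZ hK).
- by rewrite mulr_gt0// sqrtr_gt0 kappa_gt0.
Qed.

Lemma objective_gap :
  dot c (usubmx z) - dot b (dsubmx z) <= P * Num.max r (Mn z).
Proof.
have := @hz 0; rewrite linear0 => /(_ (cone0 hK)).
rewrite sub0r (_ : Mn (- z) = Mn z); last by rewrite -[- z]scaleN1r MnormZ normrN1 mul1r.
by rewrite /pdgap /Lagrangian !linear0 !(dot0r, dot0l) !(subr0, addr0, add0r).
Qed.

End Residuals.

End NormalizedGap.

(** * Strong duality under the Slater condition *)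

Section StrongDuality.
Variables (R : realType) (m n : nat) (Kp : set 'cV[R]_n).
Variables (A : 'M[R]_(m, n)) (b : 'cV[R]_m) (c : 'cV[R]_n).
Hypothesis hK : closed_convex_cone Kp.
Hypothesis hA : A != 0.

(* The point [x] minimizes [c.x + eps/2 |x|^2 + |Ax - b|^2/(2 eps)] over Kp. *)
Lemma regularized_solution (eps : R) : 0 < eps ->
  exists x s : 'cV[R]_n, [/\ Kp x, dual_cone Kp s, dot x s = 0 &
    s = c + eps *: x - eps^-1 *: (A^T *m (b - A *m x))].
Proof.
move=> e0.
pose f (x : 'cV[R]_n) := dot (c + (eps / 2) *: x) x +
  dot ((2 * eps)^-1 *: (A *m x - b)) (A *m x - b).
have cA : coord_cont (fun x : 'cV[R]_n => A *m x - b).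
  by apply: coord_contD; [apply: coord_cont_mulmx; exact: coord_cont_id
                         |exact: coord_cont_cst].
have cZ k t (g : 'cV[R]_n -> 'cV[R]_k) :
    coord_cont g -> coord_cont (fun x => t *: g x).
  move=> cg; rewrite (_ : (fun _ => _) = (fun x => t%:M *m g x)).
    exact: coord_cont_mulmx.
  by apply/funext => x; rewrite mul_scalar_mx.
have cf : continuous f.
  have c1 : continuous (fun x : 'cV[R]_n => dot (c + (eps / 2) *: x) x).
    apply: continuous_dot; last exact: coord_cont_id.
    by apply: coord_contD; [exact: coord_cont_cst|apply: cZ; exact: coord_cont_id].
  have c2 : continuous
      (fun x : 'cV[R]_n => dot ((2 * eps)^-1 *: (A *m x - b)) (A *m x - b)).
    by apply: continuous_dot => //; exact: cZ.
  by move=> x; exact: (cvgD (c1 x) (c2 x)).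
(* On the sublevel set of [f 0], [eps/2 |x|^2 <= |c| |x| + B0]; for [|x| > 1] dividing by [|x|]
   gives the second term of [B]. *)
pose B0 := f 0; pose B := 1 + 2 * (enorm c + `|B0|) / eps.
have cK : closed Kp by case: hK.
have [x Kx fx|x Kx xmin] := @closed_argmin _ _ Kp f 0 B cK (cone0 hK) cf.
  have h1 : eps / 2 * enorm x ^+ 2 <= enorm c * enorm x + B0.
    have h0 : f x <= B0 by [].
    have h2 : 0 <= dot ((2 * eps)^-1 *: (A *m x - b)) (A *m x - b).
      by rewrite dotZl mulr_ge0 ?dot_ge0// invr_ge0 mulr_ge0// ltW.
    have := dotN_le_enorm c x; move: h0; rewrite /f dotDl dotZl enorm_sqr; lra.
  have c0 := enorm_ge0 c; have x0 := enorm_ge0 x.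
  have B00 := ler_norm B0; have B01 := normr_ge0 B0.
  have [x1|x1] := leP (enorm x) 1.
    by rewrite /B (le_trans x1)// lerDl divr_ge0 ?(ltW e0)//; lra.
  suff : enorm x <= 2 * (enorm c + `|B0|) / eps by rewrite /B; lra.
  rewrite ler_pdivlMr// -(@ler_pM2r _ (enorm x)); last by lra.
  have : B0 <= `|B0| * enorm x by nra.
  lra.
pose s := c + eps *: x - eps^-1 *: (A^T *m (b - A *m x)).
have grad v t : f (x + t *: v) - f x = t * dot v s + t ^+ 2 *
    (eps / 2 * dot v v + (2 * eps)^-1 * dot (A *m v) (A *m v)).
  rewrite /f /s.
  have -> : A *m (x + t *: v) - b = (A *m x - b) + t *: (A *m v).
    by rewrite mulmxDr -scalemxAr addrAC.
  have -> : b - A *m x = - (A *m x - b) by rewrite opprB.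
  rewrite mulmxN; move: (A *m x - b) => y.
  rewrite !dotE -!dot_mulmx (dotC x v) (dotC (A *m v) y) (dotC v c).
  by field; rewrite gt_eqF.
have Ks : dual_cone Kp s.
  move=> v Kv; apply: (@ge0_quad_lin _ (eps / 2 * dot v v +
    (2 * eps)^-1 * dot (A *m v) (A *m v))) => t t0 _.
  rewrite -grad subr_ge0 xmin//.
  by apply: (coneD hK) => //; apply: (coneZ hK) => //; exact: ltW.
(* For the reverse inequality the direction is [- x], along which [(1 - t) x] stays in the cone for
   [t <= 1]. *)
exists x, s; split=> //; apply/eqP; rewrite eq_le Ks// andbT.
rewrite -oppr_ge0 -dotNl; apply: (@ge0_quad_lin _ (eps / 2 * dot (- x) (- x) +
    (2 * eps)^-1 * dot (A *m (- x)) (A *m (- x)))) => t t0 t1.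
rewrite -grad subr_ge0 xmin// scalerN -{1}[x]scale1r -scalerBl.
by apply: (coneZ hK) => //; rewrite subr_ge0.
Qed.

Variables (x0 s0 : 'cV[R]_n) (y0 : 'cV[R]_m) (r0 r1 : R).
Hypotheses (hx0 : A *m x0 = b) (hs0 : s0 = c + A^T *m y0).
Hypotheses (hr0 : 0 < r0) (hr1 : 0 < r1).
Hypotheses (Bx0 : eball x0 r0 `<=` Kp) (Bs0 : eball s0 r1 `<=` dual_cone Kp).

Lemma slater_dot_ge_primal x : Kp x -> r1 * enorm x <= dot x s0.
Proof. by move=> Kx; apply: eball_dot_ge (ltW hr1) _ => v /Bs0 /(_ x Kx). Qed.

Lemma slater_dot_ge_dual s : dual_cone Kp s -> r0 * enorm s <= dot x0 s.
Proof.
move=> Ks; rewrite dotC; apply: eball_dot_ge (ltW hr0) _ => v /Bx0 Kv.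
by rewrite dotC; exact: Ks.
Qed.

(* The regularized solutions stay bounded as eps -> 0 by the Slater points,
   hence cluster at an exact solution. *)
Lemma saddle_ex : exists zs : 'cV[R]_(n + m), saddle Kp A b c zs.
Proof.
pose C0 := dot x0 s0 + (dot x0 x0 + dot y0 y0) / 4.
pose Bx := C0 / r1; pose Bs := C0 / r0.
have reg eps : 0 < eps -> eps <= 1 ->
    exists x s : 'cV[R]_n, [/\ Kp x, dual_cone Kp s, enorm x <= Bx, enorm s <= Bs &
      [/\ dot x s = 0,
          enorm (A *m x - b) <= eps * ((enorm c + Bx + Bs) / lambda_min A) &
          exists y, s = c + eps *: x - A^T *m y]].
  move=> e0 e1; have [x [s [Kx Ks xs0 sE]]] := regularized_solution e0.
  have lm0 := lambda_min_gt0 hA.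
  pose y := eps^-1 *: (b - A *m x).
  have Axy : A *m x = b - eps *: y.
    by rewrite /y scalerA mulfV ?gt_eqF// scale1r subKr.
  have {}sE : s = c + eps *: x - A^T *m y by rewrite /y -scalemxAr.
  have yIm : y = A *m (eps^-1 *: (x0 - x)).
    by rewrite /y -hx0 -mulmxBr scalemxAr.
  (* Expand [(x - x0) . (s - s0)] using [x . s = 0]. The terms with factor [eps] are bounded by
     completing squares, which is the origin of the quarter in [C0]. *)
  clearbody y; have bound : dot x s0 + dot x0 s <= C0.
    have : dot (x - x0) (s - s0) = eps * dot x (x - x0) + eps * dot y (y + y0).
      have -> : s - s0 = eps *: x - A^T *m (y + y0).
        by rewrite sE hs0 mulmxDr; apply/colP => i; rewrite !mxE; ring.
      have e2 : dot (x - x0) (A^T *m (y + y0)) = - (eps * dot y (y + y0)).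
        by rewrite -dot_mulmx mulmxBr Axy hx0 addrAC subrr add0r dotNl dotZl.
      move: (A^T *m (y + y0)) e2 => u e2; rewrite [LHS]dotDr dotNr e2 dotZr opprK.
      by rewrite (dotC _ x).
    have hxx := dot_ge0 (x - 2^-1 *: x0); have hyy := dot_ge0 (y + 2^-1 *: y0).
    have H1 : - dot x (x - x0) <= dot x0 x0 / 4.
      move: hxx; rewrite !dotE (dotC x0 x); lra.
    have H2 : - dot y (y + y0) <= dot y0 y0 / 4.
      move: hyy; rewrite !dotE (dotC y0 y); lra.
    have := dot_ge0 x0; have := dot_ge0 y0.
    rewrite (dotDl x) (dotNl x0) !(dotDr _ s) !dotNr xs0 /C0.
    move: (dot x (x - x0)) (dot y (y + y0)) (dot x0 x0) (dot y0 y0) H1 H2.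
    by move=> a1 a2 a3 a4; nra.
  have px := slater_dot_ge_primal Kx; have ps := slater_dot_ge_dual Ks.
  have bx : enorm x <= Bx.
    rewrite ler_pdivlMr// mulrC.
    by have := enorm_ge0 s; have : 0 <= r0 * enorm s; [rewrite mulr_ge0 ?enorm_ge0// ltW|lra].
  have bs : enorm s <= Bs.
    rewrite ler_pdivlMr// mulrC.
    by have : 0 <= r1 * enorm x; [rewrite mulr_ge0 ?enorm_ge0// ltW|lra].
  exists x, s; split=> //; split=> //; last by exists y.
  (* As y lies in Im A, [lambda_min |y| <= |A^T y|], and [A^T y = c + eps x - s] is bounded
     uniformly in [eps]; hence the primal residual [eps |y|] is [O(eps)]. *)
  have := lambda_min_im hA (eps^-1 *: (x0 - x)); rewrite -yIm => ly.
  have Ay : A^T *m y = c + eps *: x - s by rewrite sE subKr.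
  have : enorm (A^T *m y) <= enorm c + Bx + Bs.
    rewrite Ay; apply: le_trans (enormD _ _) _; rewrite enormN lerD//.
    apply: le_trans (enormD _ _) _; rewrite lerD2l enormZ gtr0_norm//.
    by apply: le_trans bx; rewrite ler_piMl ?enorm_ge0.
  have -> : A *m x - b = - (eps *: y) by rewrite Axy addrAC subrr add0r.
  rewrite enormN enormZ gtr0_norm// ler_pM2l// => h.
  by rewrite ler_pdivlMr// mulrC (le_trans ly).
pose N := (cokermx A)^T.
have [CN CN0 hN] := enorm_mulmx_le N.
(* A merit function, nonnegative on the product of the cones, whose zeros there are optimal pairs.
   Minimizing it over the compact set [S] takes the place of extracting a limit, since regularized
   solutions make it at most [eps C]. *)
pose h (w : 'cV[R]_(n + n)) := dot (A *m usubmx w - b) (A *m usubmx w - b) +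
  dot (N *m (dsubmx w - c)) (N *m (dsubmx w - c)) + dot (usubmx w) (dsubmx w).
pose S := [set w : 'cV[R]_(n + n) | Kp (usubmx w)] `&`
  [set w | dual_cone Kp (dsubmx w)] `&` [set w | dot w w <= Bx ^+ 2 + Bs ^+ 2].
have ch : continuous h.
  have c1 : coord_cont (fun w : 'cV[R]_(n + n) => A *m usubmx w - b).
    apply: coord_contD; [apply: coord_cont_mulmx; exact: coord_cont_usub
                        |exact: coord_cont_cst].
  have c2 : coord_cont (fun w : 'cV[R]_(n + n) => N *m (dsubmx w - c)).
    apply: coord_cont_mulmx; apply: coord_contD; first exact: coord_cont_dsub.
    exact: coord_cont_cst.
  have d1 := continuous_dot c1 c1; have d2 := continuous_dot c2 c2.
  have d3 := continuous_dot (@coord_cont_usub R n n) (@coord_cont_dsub R n n).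
  by move=> w; exact: (cvgD (cvgD (d1 w) (d2 w)) (d3 w)).
have cS : closed S.
  apply: closedI; first apply: closedI.
  - by apply: closed_usub; case: hK.
  - by apply: closed_dsub; exact: dual_cone_closed.
  - by apply: closed_fun_le; apply: continuous_dot; exact: coord_cont_id.
have bS (w : 'cV[R]_(n + n)) : S w -> enorm w <= Num.sqrt (Bx ^+ 2 + Bs ^+ 2).
  by move=> [_ hw]; exact: ler_wsqrtr.
pose C := ((enorm c + Bx + Bs) / lambda_min A) ^+ 2 + (CN * Bx) ^+ 2.
have approx eps : 0 < eps -> eps <= 1 -> exists2 w, S w & h w <= eps * C.
  move=> e0 e1; have [x [s [Kx Ks bx bs [xs Ax [y sE]]]]] := reg eps e0 e1.
  have Bx0' : 0 <= Bx := le_trans (enorm_ge0 x) bx.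
  have Bs0' : 0 <= Bs := le_trans (enorm_ge0 s) bs.
  exists (col_mx x s).
    split; first by split => /=; rewrite ?col_mxKu ?col_mxKd.
    by rewrite /= dot_col_mx -!enorm_sqr lerD// ler_pXn2r ?nnegrE ?enorm_ge0.
  rewrite /h col_mxKu col_mxKd xs addr0 -!enorm_sqr.
  have Ns : N *m (s - c) = eps *: (N *m x).
    have -> : s - c = eps *: x - A^T *m y.
      by rewrite sE; apply/colP => i; rewrite !mxE; ring.
    rewrite mulmxBr -scalemxAr (_ : N *m (A^T *m y) = 0) ?subr0//.
    by apply/im_trmx_coker; exists y.
  have e2 : eps ^+ 2 <= eps by rewrite expr2 ler_piMl// ltW.
  have h1 : enorm (A *m x - b) ^+ 2 <=
      eps * ((enorm c + Bx + Bs) / lambda_min A) ^+ 2.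
    apply: (@le_trans _ _ ((eps * ((enorm c + Bx + Bs) / lambda_min A)) ^+ 2)).
      by rewrite ler_pXn2r ?nnegrE ?enorm_ge0// (le_trans _ Ax)// enorm_ge0.
    by rewrite [leLHS]exprMn; apply: ler_wpM2r; [exact: sqr_ge0|exact: e2].
  have h2 : enorm (N *m (s - c)) ^+ 2 <= eps * (CN * Bx) ^+ 2.
    rewrite Ns enormZ exprMn gtr0_norm//.
    apply: (@le_trans _ _ (eps ^+ 2 * (CN * Bx) ^+ 2)).
      rewrite ler_pM2l ?exprn_gt0// ler_pXn2r ?nnegrE ?enorm_ge0 ?(mulr_ge0 CN0 Bx0')//.
      by apply: le_trans (hN x) _; rewrite ler_wpM2l.
    by apply: ler_wpM2r; [exact: sqr_ge0|exact: e2].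
  rewrite /C mulrDr; lra.
have [w1 Sw1 _] := approx 1 ltr01 (lexx _).
have [w Sw wmin] := closed_argmin cS Sw1 ch (fun x Sx _ => bS x Sx).
have [[Kx Ks] _] := Sw; rewrite /= in Kx Ks.
have d1 := dot_ge0 (A *m usubmx w - b); have d2 := dot_ge0 (N *m (dsubmx w - c)).
have d3 := Ks _ Kx.
have hw0 : h w <= 0.
  rewrite leNgt; apply/negP => hw.
  have C0' : 0 <= C by rewrite addr_ge0 ?sqr_ge0.
  pose e := Num.min 1 (h w / (2 * (C + 1))).
  have p0 : 0 < 2 * (C + 1) by lra.
  have e0 : 0 < e by rewrite lt_min ltr01 divr_gt0.
  have e1 : e <= 1 by rewrite ge_min lexx.
  have e2 : e * (2 * (C + 1)) <= h w by rewrite -ler_pdivlMr// ge_min lexx orbT.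
  have [v Sv hv] := approx e e0 e1.
  have := wmin v Sv; have : 0 <= e * C by rewrite mulr_ge0// ltW.
  lra.
rewrite /h in hw0.
have Ax : A *m usubmx w = b.
  apply/eqP; rewrite -subr_eq0; apply/eqP/dot_eq0; lra.
have /im_trmx_coker[y sE] : N *m (dsubmx w - c) = 0 by apply: dot_eq0; lra.
have xs : dot (usubmx w) (dsubmx w) = 0 by lra.
(* Replace the multiplier by one in Im A with the same image under [A^T], as [saddle] demands. *)
have [v yv] := im_mulmx_tr A^T y; rewrite trmxK in yv.
have sE' : dsubmx w = c + A^T *m (A *m v) by rewrite -yv -sE addrC subrK.
exists (col_mx (usubmx w) (A *m (- v))); split; rewrite ?col_mxKu ?col_mxKd//.
- by rewrite !mulmxN opprK -sE'.
- move: xs; rewrite sE' dotDr -dot_mulmx Ax mulmxN dotNr (dotC c); lra.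
- by exists (- v).
Qed.

End StrongDuality.

(** * Geometry of the level sets *)

Section Distance.
Variables (R : realType) (k : nat).
Implicit Types (u v w : 'cV[R]_k) (S : set 'cV[R]_k).

Lemma Dist_le w v S : S v -> Dist w S <= enorm (w - v).
Proof.
move=> Sv; apply: ge_inf; last by exists v.
by exists 0 => _ [u _ <-]; exact: enorm_ge0.
Qed.

Lemma le_Dist w S (C a : R) : 0 <= C -> S !=set0 ->
  (forall v, S v -> a <= C * enorm (w - v)) -> a <= C * Dist w S.
Proof.
rewrite le_eqVlt => /predU1P[<- [v Sv] /(_ v Sv)|C0 [v0 Sv0] H].
  by rewrite !mul0r.
rewrite -ler_pdivrMl//; apply: lb_le_inf; first by exists (enorm (w - v0)), v0.
by move=> _ [v Sv <-]; rewrite ler_pdivrMl//; exact: H.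
Qed.

Lemma Dist_ge0 w S : S !=set0 -> 0 <= Dist w S.
Proof.
move=> S0; have := @le_Dist w S 1 0 ler01 S0; rewrite mul1r; apply => v _.
by rewrite mul1r enorm_ge0.
Qed.

Lemma Dist_triangle w v S : S !=set0 -> Dist w S <= enorm (w - v) + Dist v S.
Proof.
move=> S0; rewrite -lerBlDl -[Dist v S]mul1r; apply: le_Dist => // u Su.
by rewrite mul1r lerBlDl (le_trans (Dist_le _ Su))// enorm_dist.
Qed.

End Distance.

Lemma enorm_col_mx0 (R : realType) p k (u : 'cV[R]_p) :
  enorm (col_mx u (0 : 'cV[R]_k)) = enorm u.
Proof. by rewrite /enorm dot_col_mx dot0l addr0. Qed.

Lemma enorm_col_0mx (R : realType) p k (v : 'cV[R]_k) :
  enorm (col_mx (0 : 'cV[R]_p) v) = enorm v.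
Proof. by rewrite /enorm dot_col_mx dot0l add0r. Qed.

Lemma enorm_le_split (R : realType) p k (w : 'cV[R]_(p + k)) :
  enorm w <= enorm (usubmx w) + enorm (dsubmx w).
Proof.
have -> : w = col_mx (usubmx w) 0 + col_mx 0 (dsubmx w).
  by rewrite add_col_mx addr0 add0r vsubmxK.
by rewrite (le_trans (enormD _ _))// enorm_col_mx0 enorm_col_0mx
  add_col_mx addr0 add0r col_mxKu col_mxKd.
Qed.

(* Pushing [r u] by [xi v] towards the center [v] of a ball in the cone
   compensates an error [|u - k| <= xi]. *)
Lemma ball_cone_shift (R : realType) n (S : set 'cV[R]_n) (v u k : 'cV[R]_n) (r xi : R) :
  (forall t v, 0 <= t -> S v -> S (t *: v)) ->
  (forall u v, S u -> S v -> S (u + v)) ->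
  0 <= r -> (forall v', eball v r v' -> S v') -> S k -> enorm (u - k) <= xi ->
  S (r *: u + xi *: v).
Proof.
move=> SZ SD r0 Sv Sk uk.
have xi0 : 0 <= xi := le_trans (enorm_ge0 _) uk.
have [x0|xN] := eqVneq xi 0.
  have /enorm_eq0/eqP : enorm (u - k) = 0.
    by apply/eqP; rewrite eq_le enorm_ge0 -x0 uk.
  by rewrite subr_eq0 x0 scale0r addr0 => /eqP ->; exact: SZ.
(* The displaced center is at distance [r |u - k| / xi <= r] from [v]. *)
have -> : r *: u + xi *: v = r *: k + xi *: (v + (r / xi) *: (u - k)).
  rewrite scalerDr scalerA mulrCA mulfV// mulr1.
  by apply/colP => i; rewrite !mxE; ring.
apply: SD; apply: SZ => //; apply: Sv.
rewrite /eball /= addrAC subrr add0r enormZ ger0_norm ?divr_ge0//.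
by rewrite mulrAC ler_pdivrMr ?ler_wpM2l// lt_neqAle eq_sym xN.
Qed.

Section LevelSets.
Variables (R : realType) (m n : nat) (Kp : set 'cV[R]_n).
Variables (A : 'M[R]_(m, n)) (b : 'cV[R]_m) (c : 'cV[R]_n).
Hypothesis hK : closed_convex_cone Kp.
Hypothesis hA : A != 0.
Hypothesis hslater : slater Kp A b c.
Hypothesis hc : A *m c = 0.

Local Notation Gap := (Defs.Gap A b c).
Local Notation V := (Defs.V A b c).
Local Notation K := (Defs.K Kp).
Local Notation Wstar := (Defs.Wstar Kp A b c).
Local Notation Wlevel := (Defs.Wlevel Kp A b c).
Local Notation D := (Defs.D Kp A b c).
Local Notation dH := (Defs.dH Kp A b c).
Local Notation radius := (Defs.conic_radius Kp A b c).
Implicit Types (u v w : 'cV[R]_(n + n)) (delta r xi : R).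

Lemma slater_points : exists x0 y0 r0 r1,
  [/\ A *m x0 = b, 0 < r0, 0 < r1, eball x0 r0 `<=` Kp &
      eball (c + A^T *m y0) r1 `<=` dual_cone Kp].
Proof.
case: hslater => -[x0 [Ax0 /interior_eball[r0 r00 B0]]].
move=> [s0 [[y0 ->] /interior_eball[r1 r10 B1]]].
by exists x0, y0, r0, r1.
Qed.

Lemma b_im : exists x, b = A *m x.
Proof. by have [x0 [_ [_ [_ [<- _ _ _ _]]]]] := slater_points; exists x0. Qed.

Lemma dot_c_im (y : 'cV[R]_m) : dot c (A^T *m y) = 0.
Proof. by rewrite -dot_mulmx hc dot0l. Qed.

Lemma dot_q_c : dot (Defs.q A b) c = 0.
Proof. by have [y ->] := q_im A b; rewrite dotC dot_c_im. Qed.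

Lemma dot_q_im (y : 'cV[R]_m) : dot (Defs.q A b) (A^T *m y) = dot b y.
Proof. by have [x bx] := b_im; rewrite -dot_mulmx (mulmx_q (x := x)). Qed.

(** Since c lies in Null A and [A q = b], the term [q . s] equals [- b . y]: [Gap] is the usual
    difference of objectives. *)
Lemma Gap_w_of_z (z : 'cV[R]_(n + m)) :
  Gap (w_of_z A c z) = dot c (usubmx z) - dot b (dsubmx z).
Proof. by rewrite /Defs.Gap col_mxKu col_mxKd dotDr dotNr dot_q_c dot_q_im sub0r. Qed.

Lemma Gap_dot w : V w -> Gap w = dot (usubmx w) (dsubmx w).
Proof.
move=> [Ax [y sE]]; rewrite /Defs.Gap sE !dotDr dot_q_c dot_q_im add0r (dotC c).
by rewrite -dot_mulmx Ax.
Qed.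

Lemma GapD u v : Gap (u + v) = Gap u + Gap v.
Proof. by rewrite /Defs.Gap !linearD /= !dotDr; ring. Qed.

Lemma GapZ t u : Gap (t *: u) = t * Gap u.
Proof. by rewrite /Defs.Gap !linearZ /= !dotZr; ring. Qed.

(** Differences of primal points lie in Null A, differences of dual points in Im A^T. *)
Lemma V_orth u v : V u -> V v ->
  dot (usubmx u - usubmx v) (dsubmx u - dsubmx v) = 0.
Proof.
move=> [Au [y ->]] [Av [y' ->]].
rewrite opprD addrACA subrr add0r -mulmxBr -dot_mulmx mulmxBr Au Av subrr.
by rewrite dot0l.
Qed.

Lemma V_affine u v (a1 a2 : R) : a1 + a2 = 1 -> V u -> V v ->
  V (a1 *: u + a2 *: v).
Proof.
move=> a12 [Au [yu su]] [Av [yv sv]]; split.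
  rewrite /Vp /= linearD !linearZ /= mulmxDr -!scalemxAr Au Av.
  by rewrite -scalerDl a12 scale1r.
exists (a1 *: yu + a2 *: yv); rewrite linearD !linearZ /= su sv.
rewrite mulmxDr -!scalemxAr !scalerDr addrACA -scalerDl a12 scale1r//.
Qed.

Lemma KD u v : K u -> K v -> K (u + v).
Proof.
move=> [u1 u2] [v1 v2]; split; rewrite linearD /=; first exact: coneD.
exact: dual_coneD.
Qed.

Lemma KZ t u : 0 <= t -> K u -> K (t *: u).
Proof.
move=> t0 [u1 u2]; split; rewrite linearZ /=; first exact: coneZ.
exact: dual_coneZ.
Qed.

Lemma Gap_ge0 w : V w -> K w -> 0 <= Gap w.
Proof. by move=> Vw [Kx Ks]; rewrite Gap_dot// Ks. Qed.

Lemma Wstar_saddle w : Wstar w -> exists2 zs, saddle Kp A b c zs &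
  w_of_z A c zs = w.
Proof.
move=> [[[Ax [y sE]] [Kx Ks]] G0].
have [v yv] := im_mulmx_tr A^T y; rewrite trmxK in yv.
have wE : w_of_z A c (col_mx (usubmx w) (A *m (- v))) = w.
  rewrite /w_of_z col_mxKu col_mxKd !mulmxN opprK -yv.
  by rewrite -[RHS]vsubmxK sE.
exists (col_mx (usubmx w) (A *m (- v))) => //.
split; rewrite ?col_mxKu ?col_mxKd//; last by exists (- v).
- by rewrite !mulmxN opprK -yv -sE.
- have := Gap_w_of_z (col_mx (usubmx w) (A *m (- v))).
  by rewrite wE col_mxKu col_mxKd G0 => /esym/eqP; rewrite subr_eq0 => /eqP.
Qed.

Lemma saddle_Wstar zs : saddle Kp A b c zs -> Wstar (w_of_z A c zs).
Proof.
move=> [Kx Ax Ks e _]; split; last by rewrite /= Gap_w_of_z e subrr.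
split; split; rewrite ?col_mxKu ?col_mxKd//.
by exists (- dsubmx zs); rewrite mulmxN.
Qed.

Lemma Wstar_nonempty : Wstar !=set0.
Proof.
have [x0 [y0 [r0 [r1 [Ax0 r00 r10 B0 B1]]]]] := slater_points.
have [zs hs] := saddle_ex hK hA Ax0 erefl r00 r10 B0 B1.
by exists (w_of_z A c zs); exact: saddle_Wstar.
Qed.

Lemma Wstar_level delta w : 0 < delta -> Wstar w -> Wlevel delta w.
Proof. by move=> d0 [Fw G0]; split=> //=; rewrite G0 ltW. Qed.

(** Orthogonality against a Slater pair gives [x . s0 + x0 . s <= delta + x0 . s0], and both
    products are coercive on the cones. Boundedness makes the suprema in [D] and [dH] genuine. *)
Lemma Wlevel_bounded delta : exists B, forall w, Wlevel delta w -> enorm w <= B.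
Proof.
have [x0 [y0 [r0 [r1 [Ax0 r00 r10 B0 B1]]]]] := slater_points.
set s0 := c + _ in B1; have s0E : s0 = c + A^T *m y0 by []; clearbody s0.
exists ((delta + dot x0 s0) / r0 + (delta + dot x0 s0) / r1).
move=> w [[Vw [Kx Ks]] /= Gw].
have V0 : V (col_mx x0 s0) by split; rewrite ?col_mxKu ?col_mxKd//; exists y0.
have := V_orth Vw V0; rewrite col_mxKu col_mxKd.
rewrite Gap_dot// in Gw.
have e : dot (usubmx w - x0) (dsubmx w - s0) =
    dot (usubmx w) (dsubmx w) - dot (usubmx w) s0 - dot x0 (dsubmx w) + dot x0 s0.
  by rewrite dotDl dotNl !dotDr !dotNr; ring.
rewrite e => {}e.
have h1 := slater_dot_ge_primal r10 B1 Kx.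
have h2 := slater_dot_ge_dual r00 B0 Ks.
have h3 : 0 <= r1 * enorm (usubmx w) by rewrite mulr_ge0 ?enorm_ge0// ltW.
have h4 : 0 <= r0 * enorm (dsubmx w) by rewrite mulr_ge0 ?enorm_ge0// ltW.
apply: le_trans (enorm_le_split w) _; rewrite addrC; apply: lerD.
  by rewrite ler_pdivlMr// mulrC; lra.
by rewrite ler_pdivlMr// mulrC; lra.
Qed.

Lemma le_D delta u v : Wlevel delta u -> Wlevel delta v -> enorm (u - v) <= D delta.
Proof.
move=> Wu Wv; apply: ub_le_sup; last by exists u, v.
have [B HB] := Wlevel_bounded delta.
exists (B + B) => _ [u' [v' [Wu' Wv' ->]]].
by rewrite (le_trans (enormD _ _))// enormN lerD ?HB.
Qed.

Lemma le_dH delta w : Wlevel delta w -> Dist w Wstar <= dH delta.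
Proof.
move=> Ww; apply: ub_le_sup; last by exists w.
have [B HB] := Wlevel_bounded delta; have [ws Ws] := Wstar_nonempty.
exists (B + enorm ws) => _ [u Wu <-].
apply: le_trans (Dist_le _ Ws) _; apply: le_trans (enormD _ _) _.
by rewrite enormN lerD2r HB.
Qed.

Lemma dH_ge0 delta : 0 < delta -> 0 <= dH delta.
Proof.
move=> d0; have [ws Ws] := Wstar_nonempty.
apply: le_trans (le_dH (Wstar_level d0 Ws)).
by apply: Dist_ge0; exact: Wstar_nonempty.
Qed.

Lemma eball_K_usub w r : eball w r `<=` K -> eball (usubmx w) r `<=` Kp.
Proof.
move=> BK x hx; have [] := BK (col_mx x (dsubmx w)); last by rewrite col_mxKu.
rewrite /eball /= -[w in enorm (_ - w)]vsubmxK opp_col_mx add_col_mx subrr.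
by rewrite enorm_col_mx0.
Qed.

Lemma eball_K_dsub w r : eball w r `<=` K -> eball (dsubmx w) r `<=` dual_cone Kp.
Proof.
move=> BK x hx; have [] := BK (col_mx (usubmx w) x); last by rewrite col_mxKd.
rewrite /eball /= -[w in enorm (_ - w)]vsubmxK opp_col_mx add_col_mx subrr.
by rewrite enorm_col_0mx.
Qed.

(** Moving the dual part of the center by length [r] along Im A^T stays in the affine space and in
    the ball, so it produces a second point of the level set. *)
Lemma radius_le_D delta r w : 0 <= r -> Wlevel delta w -> eball w r `<=` K ->
  r <= D delta.
Proof.
move=> r0 Ww BK; have [y yN] := tr_mulmx_neq0_ex hA.
pose d := A^T *m y.
have dN : 0 < enorm d.
  by rewrite lt_neqAle enorm_ge0 andbT eq_sym; apply: contra_neq yN; exact: enorm_eq0.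
(* The sign is chosen so that the move does not increase [Gap]. *)
pose e := if dot (Defs.q A b) d <= 0 then r / enorm d else - (r / enorm d).
have en : `|e| = r / enorm d.
  by rewrite /e; case: ifP => _; rewrite ?normrN ger0_norm// divr_ge0// ltW.
pose v := col_mx (0 : 'cV[R]_n) (e *: d).
have vn : enorm v = r by rewrite enorm_col_0mx enormZ en divfK// gt_eqF.
have Wv : Wlevel delta (w + v).
  case: Ww => -[[Ax [y' sE]] Kw] /= Gw; split; first split.
  - split; first by rewrite /Vp /= linearD /= col_mxKu addr0.
    exists (y' + e *: y); rewrite linearD /= col_mxKd sE mulmxDr -scalemxAr.
    by rewrite addrA.
  - by apply: BK; rewrite /eball /= addrAC subrr add0r vn.
  - rewrite /= GapD; suff : Gap v <= 0 by move: Gw; lra.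
    rewrite /Defs.Gap col_mxKu col_mxKd dot0r add0r dotZr /e.
    have q0 : 0 <= r / enorm d by rewrite divr_ge0// ltW.
    case: ifPn => h; first by rewrite mulr_ge0_le0.
    by rewrite mulNr oppr_le0 mulr_ge0// ltW// ltNge.
have := le_D Wv Ww; by rewrite addrAC subrr add0r vn.
Qed.

Lemma conic_radius_set_ub delta : has_ubound
  [set r | 0 <= r /\ exists2 w, Wlevel delta w & eball w r `<=` K].
Proof. by exists (D delta) => r [r0 [w Ww BK]]; exact: radius_le_D Ww BK. Qed.

(** A convex combination of a Slater pair and an optimal pair keeps a ball of radius [th rm], and
    the weight [th] can be chosen to bring the gap below [delta]. *)
Lemma conic_radius_gt0 delta : 0 < delta -> 0 < radius delta.
Proof.
move=> d0; have [x0 [y0 [r0 [r1 [Ax0 r00 r10 B0 B1]]]]] := slater_points.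
have [ws [[Vs Ks] Gs]] := Wstar_nonempty.
set s0 := c + _ in B1; pose w0 := col_mx x0 s0.
have V0 : V w0 by split; rewrite ?col_mxKu ?col_mxKd//; exists y0.
pose rm := Num.min r0 r1.
have rm0 : 0 < rm by rewrite lt_min r00 r10.
have BK : eball w0 rm `<=` K.
  move=> v hv; split.
    apply: B0; rewrite /eball /=; apply: (@le_trans _ _ rm); last by rewrite ge_min lexx.
    by apply: le_trans hv; have := enorm_usub (v - w0); rewrite linearB /= col_mxKu.
  apply: B1; rewrite /eball /=; apply: (@le_trans _ _ rm); last by rewrite ge_min lexx orbT.
  by apply: le_trans hv; have := enorm_dsub (v - w0); rewrite linearB /= col_mxKd.
have K0 : K w0 by apply: BK; rewrite /eball /= subrr enorm0 ltW.
have g0 := Gap_ge0 V0 K0; set g := Gap w0 in g0.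
have dg : 0 < delta + g by lra.
pose th := delta / (delta + g).
have th0 : 0 < th by rewrite divr_gt0.
have th1 : th <= 1 by rewrite ler_pdivrMr// mul1r lerDl.
have thg : th * g <= delta.
  by rewrite /th mulrAC ler_pdivrMr// ler_pM2l// lerDr ltW.
apply: (@lt_le_trans _ _ (th * rm)); first by rewrite mulr_gt0.
apply: ub_le_sup; first exact: conic_radius_set_ub.
split; first by rewrite mulr_ge0// ltW.
exists (th *: w0 + (1 - th) *: ws).
  split; first split.
  - by apply: V_affine => //; rewrite addrC subrK.
  - by apply: KD; apply: KZ => //; rewrite ?subr_ge0// ltW.
  - by rewrite /= GapD !GapZ Gs mulr0 addr0.
move=> v hv.
have -> : v = th *: (w0 + th^-1 *: (v - (th *: w0 + (1 - th) *: ws))) + (1 - th) *: ws.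
  rewrite scalerDr scalerA mulfV ?gt_eqF// scale1r.
  by apply/colP => i; rewrite !mxE; ring.
apply: KD; apply: KZ => //; rewrite ?subr_ge0// ?(ltW th0)//.
apply: BK; rewrite /eball /= addrAC subrr add0r enormZ ger0_norm ?invr_ge0 ?(ltW th0)//.
by rewrite ler_pdivrMl.
Qed.

Lemma conic_radius_le_D delta : 0 < delta -> radius delta <= D delta.
Proof.
move=> d0; have r0 := conic_radius_gt0 d0; apply: ge_sup.
  apply: contrapT => /nonemptyPn h; move: r0.
  by rewrite /Defs.conic_radius h sup0 ltxx.
by move=> r [rr [w Ww BK]]; exact: radius_le_D Ww BK.
Qed.

End LevelSets.

(** * The error bound *)

Section ErrorBound.
Variables (R : realType) (m n : nat) (Kp : set 'cV[R]_n).
Variables (A : 'M[R]_(m, n)) (b : 'cV[R]_m) (c : 'cV[R]_n).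
Hypothesis hK : closed_convex_cone Kp.
Hypothesis hA : A != 0.
Hypothesis hslater : slater Kp A b c.
Hypothesis hc : A *m c = 0.

Local Notation Gap := (Defs.Gap A b c).
Local Notation V := (Defs.V A b c).
Local Notation K := (Defs.K Kp).
Local Notation Wstar := (Defs.Wstar Kp A b c).
Local Notation Wlevel := (Defs.Wlevel Kp A b c).
Local Notation D := (Defs.D Kp A b c).
Local Notation dH := (Defs.dH Kp A b c).
Local Notation radius := (Defs.conic_radius Kp A b c).
Local Notation d0 := (Dist 0 Wstar).
Implicit Types (u v w : 'cV[R]_(n + n)) (delta r xi : R).

(** Residuals are recorded by witnesses because the level-set construction combines them. Only
    primal affine feasibility and dual conic feasibility can fail. The factor [2 sqrt 2] comes from
    the M-norm bounds [admissible_move0] and [admissible_norm]. *)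
Definition near_optimal xi w : Prop :=
  [/\ Kp (usubmx w), Vd A c (dsubmx w),
      exists2 x, A *m x = b & enorm (usubmx w - x) <= xi,
      exists2 p, dual_cone Kp (dsubmx w + p) & enorm p <= xi
    & Gap w <= 2 * Num.sqrt 2 * xi * d0].

Lemma near_optimal_Econs xi w : near_optimal xi w -> Econs Kp A b c w <= xi.
Proof.
move=> [Kx Vs [x Ax dx] [p Kp' pxi] _]; rewrite /Econs ge_max; apply/andP; split.
  apply: (le_trans (Dist_le _ (_ : V (col_mx x (dsubmx w))))).
    by split; rewrite ?col_mxKu ?col_mxKd.
  by rewrite -{1}[w]vsubmxK opp_col_mx add_col_mx subrr enorm_col_mx0.
apply: (le_trans (Dist_le _ (_ : K (col_mx (usubmx w) (dsubmx w + p))))).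
  by split; rewrite ?col_mxKu ?col_mxKd.
rewrite -{1}[w]vsubmxK opp_col_mx add_col_mx subrr enorm_col_0mx.
by rewrite opprD addrA subrr add0r enormN.
Qed.

(** As c is orthogonal to Im A^T, it is the point of [Vd] nearest to 0. *)
Lemma enorm_c_le w : V w -> enorm c <= enorm w.
Proof.
move=> [_ [y sE]]; apply: le_trans (enorm_dsub w).
rewrite ler_wsqrtr// sE !dotDl !dotDr (dotC _ c) (dot_c_im hc) addr0 add0r.
by rewrite lerDl dot_ge0.
Qed.

(* For w = (x, s) in the level set, x.s* + s.x* = x.s <= delta while x and s
   are centers of balls of radius r in the two cones. *)
Lemma radius_Wstar delta r w ws : 0 <= r -> Wlevel delta w -> eball w r `<=` K ->
  Wstar ws -> r * enorm ws <= delta.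
Proof.
move=> r0 [[Vw Kw] /= Gw] BK [[Vs [Kxs Kss]] /= Gs].
rewrite (Gap_dot hslater hc Vw) in Gw; rewrite (Gap_dot hslater hc Vs) in Gs.
have h1 : r * enorm (usubmx ws) <= dot (usubmx ws) (dsubmx w).
  by apply: eball_dot_ge => // s /(eball_K_dsub BK); exact.
have h2 : r * enorm (dsubmx ws) <= dot (dsubmx ws) (usubmx w).
  apply: eball_dot_ge => // x /(eball_K_usub BK) Kx.
  by rewrite dotC; exact: Kss.
have := V_orth Vw Vs.
have -> : dot (usubmx w - usubmx ws) (dsubmx w - dsubmx ws) =
    dot (usubmx w) (dsubmx w) - dot (dsubmx ws) (usubmx w)
    - dot (usubmx ws) (dsubmx w) + dot (usubmx ws) (dsubmx ws).
  by rewrite !dotDl !dotNl !dotDr !dotNr (dotC (dsubmx ws)); ring.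
have := ler_wpM2l r0 (enorm_le_split ws); rewrite mulrDr Gs; lra.
Qed.

(* With [mu = 1 + 2 sqrt 2], the combination of the affine projection of [w],
   the center [wd] and an optimal [ws] with weights r, xi, mu xi lies in the
   level set. *)
Lemma level_error_bound delta r xi wd w : 0 < delta -> 0 <= r -> 0 <= xi ->
  Wlevel delta wd -> eball wd r `<=` K -> near_optimal xi w ->
  r * (Dist w Wstar - xi - dH delta) <= (2 + 2 * Num.sqrt 2) * xi * D delta.
Proof.
move=> dp r0 xi0 Wd BK [Kx Vs [xh Axh dxh] [p Kpp dp'] Gw].
have s2 : 0 <= Num.sqrt 2 :> R by exact: sqrtr_ge0.
have [ws Ws] := Wstar_nonempty hK hA hslater hc.
have Wsl := Wstar_level dp Ws.
have D0 : 0 <= D delta by have := le_D hslater hc Wd Wd; rewrite subrr enorm0.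
move: r0; rewrite le_eqVlt => /predU1P[<-|r0].
  by rewrite mul0r !mulr_ge0//; lra.
pose wh := col_mx xh (dsubmx w).
have Vwh : V wh by split; rewrite ?col_mxKu ?col_mxKd.
have dwh : enorm (w - wh) <= xi.
  by rewrite -{1}[w]vsubmxK opp_col_mx add_col_mx subrr enorm_col_mx0.
(* Replacing x by [xh] costs at most [|c| xi <= |ws| xi], which is the 1 in [1 + 2 sqrt 2]; then
   [radius_Wstar] trades [r |ws|] for [delta]. *)
have Gwh : r * Gap wh <= (1 + 2 * Num.sqrt 2) * xi * delta.
  have Gle : Gap wh <= (1 + 2 * Num.sqrt 2) * xi * enorm ws.
    have d0le : d0 <= enorm ws.
      by have := Dist_le 0 Ws; rewrite sub0r enormN.
    have h1 : 2 * Num.sqrt 2 * xi * d0 <= 2 * Num.sqrt 2 * xi * enorm ws.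
      by apply: ler_wpM2l => //; rewrite !mulr_ge0.
    have -> : Gap wh = Gap w - dot c (usubmx w - xh).
      by rewrite /Defs.Gap col_mxKu col_mxKd dotDr dotNr; ring.
    have h2 := dotN_le_enorm c (usubmx w - xh).
    have h3 : enorm c * enorm (usubmx w - xh) <= enorm ws * xi.
      by apply: ler_pM; rewrite ?enorm_ge0//; apply: enorm_c_le; case: Ws => -[].
    lra.
  apply: (@le_trans _ _ (r * ((1 + 2 * Num.sqrt 2) * xi * enorm ws))).
    by rewrite ler_pM2l.
  have := radius_Wstar (ltW r0) Wd BK Ws => h.
  have -> : r * ((1 + 2 * Num.sqrt 2) * xi * enorm ws) =
    (1 + 2 * Num.sqrt 2) * xi * (r * enorm ws) by ring.
  by apply: ler_wpM2l => //; rewrite mulr_ge0//; lra.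
pose mu := 1 + 2 * Num.sqrt 2 : R.
have mu0 : 0 <= mu by rewrite /mu; lra.
pose t := r + xi + mu * xi.
have mx : 0 <= mu * xi by rewrite mulr_ge0.
have t0 : 0 < t by rewrite /t; lra.
pose w' := t^-1 *: ((r *: wh + xi *: wd) + (mu * xi) *: ws).
have tw' : t *: w' = r *: wh + xi *: wd + (mu * xi) *: ws.
  by rewrite scalerA mulfV ?gt_eqF// scale1r.
have [[Vd' Kd'] Gd] := Wd; have [[Vst Kst] Gst] := Ws; rewrite /= in Gd Gst.
have Ww' : Wlevel delta w'.
  split; first split.
  - have rx : 0 < r + xi by lra.
    have -> : w' = ((r + xi) / t) *: ((r / (r + xi)) *: wh + (xi / (r + xi)) *: wd)
        + (mu * xi / t) *: ws.
      rewrite /w' 2!scalerDr !scalerA (scalerDr ((r + xi) / t)) !scalerA.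
      congr (_ *: _ + _ *: _ + _ *: _); field; rewrite ?gt_eqF//.
    apply: V_affine; first by rewrite -mulrDl mulfV// gt_eqF.
      by apply: V_affine => //; rewrite -mulrDl mulfV// gt_eqF.
    by [].
  - apply: (KZ hK); first by rewrite invr_ge0 ltW.
    apply: (KD hK); last by apply: (KZ hK).
    have [Kdx Kds] := Kd'.
    split; rewrite linearD !linearZ /= ?col_mxKu ?col_mxKd.
      apply: (@ball_cone_shift _ _ Kp _ _ (usubmx w)) => //.
      + by move=> *; exact: (coneZ hK).
      + by move=> *; exact: (coneD hK).
      + exact: ltW.
      + exact: eball_K_usub BK.
      + by rewrite enormB.
    apply: (@ball_cone_shift _ _ (dual_cone Kp) _ _ (dsubmx w + p)) => //.
    + by move=> *; exact: dual_coneZ.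
    + by move=> *; exact: dual_coneD.
    + exact: ltW.
    + exact: eball_K_dsub BK.
    + by rewrite opprD addrA subrr add0r enormN.
  - rewrite /= -(ler_pM2l t0) -GapZ tw' !GapD !GapZ Gst mulr0 addr0.
    have := ler_wpM2l xi0 Gd; have := ler_wpM2r (ltW dp) (ltW r0).
    rewrite mul0r /t /mu; lra.
have h1 : r * enorm (wh - w') <= (2 + 2 * Num.sqrt 2) * xi * D delta.
  have -> : r * enorm (wh - w') = enorm (r *: (wh - w')).
    by rewrite enormZ gtr0_norm.
  (* Here [w'], [wd] and [ws] all lie in the level set, so each difference has norm at most
     [D delta]. *)
  have -> : r *: (wh - w') = xi *: (w' - wd) + (mu * xi) *: (w' - ws).
    have e : r *: wh = t *: w' - xi *: wd - (mu * xi) *: ws.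
      by rewrite tw'; apply/colP => i; rewrite !mxE; ring.
    by rewrite scalerBr e /t; apply/colP => i; rewrite !mxE; ring.
  apply: le_trans (enormD _ _) _; rewrite !enormZ !ger0_norm//.
  have a1 := ler_wpM2l xi0 (le_D hslater hc Ww' Wd).
  have a2 := ler_wpM2l mx (le_D hslater hc Ww' Wsl).
  have -> : (2 + 2 * Num.sqrt 2) * xi * D delta = xi * D delta + mu * xi * D delta.
    by rewrite /mu; ring.
  lra.
have h2 : Dist w Wstar <= xi + enorm (wh - w') + dH delta.
  have := Dist_triangle w w' (Wstar_nonempty hK hA hslater hc).
  have := enorm_dist w wh w'; have := le_dH hK hA hslater hc Ww'; lra.
apply: le_trans h1; rewrite ler_pM2l//; lra.
Qed.

(** The bound for each inscribed ball passes to the supremum of the radii after division by the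
    excess [E], if positive. The remaining [xi] is absorbed by [D/r >= 1], turning 2 into 3. *)
Lemma Dist_Wstar_le delta xi w : 0 < delta -> 0 <= xi -> near_optimal xi w ->
  Dist w Wstar <= (3 + 2 * Num.sqrt 2) * xi * (D delta / radius delta) + dH delta.
Proof.
move=> dp xi0 hw.
have s2 : 0 <= Num.sqrt 2 :> R by exact: sqrtr_ge0.
have r0 := conic_radius_gt0 hK hA hslater hc dp.
have rD := conic_radius_le_D hK hA hslater hc dp.
have DR : 1 <= D delta / radius delta by rewrite ler_pdivlMr// mul1r.
set E := Dist w Wstar - xi - dH delta.
have x1 : xi <= xi * (D delta / radius delta) by rewrite ler_peMr.
suff : E <= (2 + 2 * Num.sqrt 2) * xi * (D delta / radius delta) by rewrite /E; lra.
have [E0|E0] := leP E 0.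
  apply: (le_trans E0); apply: mulr_ge0; last by lra.
  by apply: mulr_ge0 => //; lra.
have : radius delta <= (2 + 2 * Num.sqrt 2) * xi * D delta / E.
  apply: ge_sup.
    apply: contrapT => /nonemptyPn h; move: r0.
    by rewrite /Defs.conic_radius h sup0 ltxx.
  move=> r [rr [wd Wd BK]]; rewrite ler_pdivlMr//.
  exact: level_error_bound Wd BK hw.
by rewrite ler_pdivlMr// mulrC -ler_pdivlMr// mulrA.
Qed.

End ErrorBound.

(** * Outer iterations *)

Section OuterIteration.
Variables (R : realType) (m n : nat) (Kp : set 'cV[R]_n).
Variables (A : 'M[R]_(m, n)) (b : 'cV[R]_m) (c : 'cV[R]_n).
Hypothesis hK : closed_convex_cone Kp.
Hypothesis hA : A != 0.
Hypothesis hslater : slater Kp A b c.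
Hypothesis hc : A *m c = 0.

Local Notation tau := (kappa A)^-1.
Local Notation sigma := (lambda_max A * lambda_min A)^-1.
Local Notation "'Mn' z" := (Mnorm A tau sigma z) (at level 10, z at level 9).
Local Notation avg := (pdhg_avg Kp A b c tau sigma).
Local Notation rho := (Defs.rho Kp A b c tau sigma).
Local Notation w_of := (w_of_z A c).
Local Notation Wstar := (Defs.Wstar Kp A b c).
Local Notation d0 := (Dist 0 Wstar).
Local Notation saddle := (saddle Kp A b c).
Local Notation near := (near_optimal Kp A b c).
Local Notation s2k := (Num.sqrt 2 * Num.sqrt (kappa A)).
Implicit Types (z zp zs : 'cV[R]_(n + m)).

Let s2k0 : 0 <= s2k. Proof. by rewrite mulr_ge0 ?sqrtr_ge0. Qed.

Lemma Mnorm_dist_le z zs : (exists v, dsubmx z = A *m v) -> saddle zs ->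
  Mn (zs - z) <= s2k * enorm (w_of z - w_of zs).
Proof.
move=> [v zv] [_ _ _ _ [vs zsv]].
have e : dsubmx (zs - z) = A *m (vs - v) by rewrite linearB /= zv zsv mulmxBr.
apply: le_trans (Mnorm_le hA e) _; apply: ler_wpM2l => //.
rewrite ler_wsqrtr// opp_col_mx add_col_mx !dot_col_mx.
have -> : c - A^T *m dsubmx z - (c - A^T *m dsubmx zs) = A^T *m dsubmx (zs - z).
  have -> : dsubmx (zs - z) = dsubmx zs - dsubmx z by rewrite linearB.
  rewrite mulmxBr.
  by rewrite opprD opprK addrACA subrr add0r addrC.
have -> : usubmx z - usubmx zs = - usubmx (zs - z) by rewrite linearB /= opprB.
by rewrite dotNl dotNr opprK.
Qed.

Lemma Mnorm_saddle_le zs : saddle zs -> Mn zs <= s2k * enorm (w_of zs).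
Proof.
move=> [_ _ _ _ [vs zsv]].
apply: le_trans (Mnorm_le hA zsv) _; apply: ler_wpM2l => //.
rewrite ler_wsqrtr// !dot_col_mx lerD2l !dotDl !dotDr !dotNl !dotNr opprK.
rewrite (dotC _ c) (dot_c_im hc) oppr0 addr0 add0r.
by rewrite lerDr dot_ge0.
Qed.

(* Invariants of the outer iterates of a run started at 0. *)
Definition admissible z : Prop :=
  [/\ Kp (usubmx z), exists v, dsubmx z = A *m v
    & forall zs, saddle zs -> Mn (zs - z) <= Mn zs].

Lemma admissible0 : admissible 0.
Proof.
split; first by rewrite linear0; exact: cone0.
  by exists 0; rewrite linear0 mulmx0.
by move=> zs _; rewrite subr0.
Qed.

Lemma avg_admissible z k : (0 < k)%N -> admissible z -> admissible (avg z k).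
Proof.
move=> k0 [Kz zv zf]; split; first exact: avg_cone.
  by apply: avg_im => //; exact: b_im hslater.
by move=> zs hs; apply: le_trans (avg_fejer hK hA z k0 hs) (zf _ hs).
Qed.

Lemma le_Dist_Wstar w (C a : R) : 0 <= C ->
  (forall zs, saddle zs -> a <= C * enorm (w - w_of zs)) -> a <= C * Dist w Wstar.
Proof.
move=> C0 H; apply: le_Dist => //; first exact: Wstar_nonempty.
by move=> _ /(Wstar_saddle hslater hc)[zs hs <-]; exact: H.
Qed.

Lemma admissible_move z k : (0 < k)%N -> admissible z ->
  Mn (avg z k - z) <= 2 * s2k * Dist (w_of z) Wstar.
Proof.
move=> k0 [_ zv _]; apply: le_Dist_Wstar; first by rewrite mulr_ge0.
move=> zs hs; apply: le_trans (avg_move hK hA z k0 hs) _.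
by rewrite -mulrA ler_pM2l// Mnorm_dist_le.
Qed.

Lemma admissible_move0 z k : (0 < k)%N -> admissible z ->
  Mn (avg z k - z) <= 2 * s2k * d0.
Proof.
move=> k0 [_ _ zf]; apply: le_Dist_Wstar; first by rewrite mulr_ge0.
move=> zs hs; apply: le_trans (avg_move hK hA z k0 hs) _.
rewrite sub0r enormN -mulrA ler_pM2l//.
exact: le_trans (zf _ hs) (Mnorm_saddle_le hs).
Qed.

Lemma admissible_norm z : admissible z -> Mn z <= 2 * s2k * d0.
Proof.
move=> [_ _ zf]; apply: le_Dist_Wstar; first by rewrite mulr_ge0.
move=> zs hs; rewrite sub0r enormN -mulrA.
have := Mnorm_dist hA z zs 0; rewrite !subr0 (MnormB _ z zs).
have := zf _ hs; have := Mnorm_saddle_le hs; lra.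
Qed.

Lemma avg_near_optimal zp k P : (0 < k)%N -> admissible zp ->
  rho (Mn (avg zp k - zp)) (avg zp k) = P%:E ->
  near (Num.sqrt (kappa A) * P) (w_of (avg zp k)).
Proof.
move=> k0 azp rP; set z := avg zp k in rP *.
have az : admissible z by exact: avg_admissible.
have [Kz [v zv] _] := az.
have P0 : 0 <= P by have := rho_ge0 A b c (Mnorm_ge0 A (z - zp)) Kz; rewrite rP lee_fin.
have ctl zh : Kp (usubmx zh) ->
    pdgap A b c z zh <= P * Num.max (Mn (z - zp)) (Mn (zh - z)).
  by move=> Kzh; exact: (avg_control hK hA k0 rP Kzh).
have mv : Mn (z - zp) <= 2 * s2k * d0 by exact: admissible_move0.
have [x1 bx] := b_im hslater.
clearbody z; clear rP k0.
split.
- by rewrite col_mxKu.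
- by exists (- dsubmx z); rewrite col_mxKd mulmxN.
(* The factor [lambda_min] of the residual cancels the one of [near_affine], so primal and dual
   errors get the same bound. *)
- have [xh Axh dxh] := near_affine hA (usubmx z) x1.
  exists xh; rewrite ?Axh// col_mxKu.
  have := primal_residual hA P0 ctl Kz; rewrite [in X in enorm (X - _)]bx.
  move=> /(le_trans dxh).
  by rewrite mulrC ler_pM2r// lambda_min_gt0.
- by have := dual_residual hK hA P0 ctl Kz; rewrite col_mxKd.
- rewrite (Gap_w_of_z hslater hc); apply: le_trans (objective_gap hK ctl) _.
  have -> : 2 * Num.sqrt 2 * (Num.sqrt (kappa A) * P) * d0 = P * (2 * s2k * d0) by ring.
  apply: ler_wpM2l => //; rewrite ge_max mv /=; exact: admissible_norm.
Qed.

Lemma near_within_tol epscons epsgap xi z : 0 < epscons -> 0 < epsgap ->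
  near xi (w_of z) -> xi * inv_tol Kp A b c epscons epsgap <= 1 -> 0 <= xi ->
  within_tol Kp A b c epscons epsgap z.
Proof.
move=> ec0 eg0 nz hxi xi0; split.
  apply: le_trans (near_optimal_Econs nz) _.
  rewrite -(mulr1 epscons) -ler_pdivrMl// mulrC; apply: le_trans hxi.
  by apply: ler_wpM2l => //; rewrite /inv_tol le_max div1r lexx.
have [_ _ _ _ G] := nz; rewrite /Egap ge_max (ltW eg0) /=.
apply: le_trans G _; rewrite -(mulr1 epsgap) -ler_pdivrMl//.
apply: le_trans hxi.
have -> : epsgap^-1 * (2 * Num.sqrt 2 * xi * d0) =
  xi * (2 * Num.sqrt 2 * d0 / epsgap) by ring.
by apply: ler_wpM2l => //; rewrite /inv_tol le_max lexx orbT.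
Qed.

(** The start is (0, c). An optimal (x, s) gives the point (x, c) of [V] and the point (0, s) of
    [K]; orthogonality of c to Im A^T bounds [|c - s|] by [|s|]. *)
Lemma start_Econs : Econs Kp A b c (w_of 0) <= d0.
Proof.
rewrite -[d0]mul1r; apply: le_Dist_Wstar => // zs hs.
have [Kx Ax Ks _ _] := hs.
have sn : enorm (A^T *m dsubmx zs) <= enorm (w_of zs).
  apply: le_trans (enorm_dsub _); rewrite col_mxKd ler_wsqrtr//.
  rewrite !dotDl !dotDr !dotNl !dotNr opprK (dotC _ c) (dot_c_im hc).
  by rewrite oppr0 addr0 add0r lerDr dot_ge0.
rewrite sub0r enormN mul1r /Econs ge_max; apply/andP; split.
  apply: (le_trans (Dist_le _ (_ : Defs.V A b c (col_mx (usubmx zs) c)))).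
    by split; rewrite ?col_mxKu ?col_mxKd//; exists 0; rewrite mulmx0 addr0.
  rewrite /w_of_z !linear0 addr0 opp_col_mx add_col_mx subrr add0r enorm_col_mx0.
  by rewrite enormN; have := enorm_usub (w_of zs); rewrite col_mxKu.
apply: (le_trans (Dist_le _ (_ : Defs.K Kp (col_mx 0 (c - A^T *m dsubmx zs))))).
  by split; rewrite ?col_mxKu ?col_mxKd//; exact: cone0.
rewrite /w_of_z !linear0 addr0 opp_col_mx add_col_mx subrr enorm_col_0mx.
by rewrite subKr.
Qed.

(** The gap at the start is 0, so only infeasibility can make it unacceptable. *)
Lemma start_within_tol epscons epsgap : 0 < epscons -> 0 < epsgap ->
  ~ within_tol Kp A b c epscons epsgap 0 ->
  1 < d0 * inv_tol Kp A b c epscons epsgap.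
Proof.
move=> ec0 eg0 nw; rewrite ltNge; apply/negP => h; apply: nw; split.
  apply: le_trans start_Econs _; rewrite -(mulr1 epscons) -ler_pdivrMl// mulrC.
  apply: le_trans h; apply: ler_wpM2l.
    by apply: Dist_ge0; exact: Wstar_nonempty.
  by rewrite /inv_tol le_max div1r lexx.
rewrite /Egap (Gap_w_of_z hslater hc) !linear0 !dot0r subrr maxxx ltW//.
Qed.

End OuterIteration.

(** * Counting iterations *)

Section Numerics.
Variable R : realType.

Lemma expR1_ge2 : 2 <= expR 1 :> R.
Proof. by have := expR_ge1Dx (1 : R); rewrite -natr1. Qed.

(** From [exp(-1/10) >= 9/10], raised to the tenth power. *)
Lemma expR1_le : expR 1 <= 29 / 10 :> R.
Proof.
have h : 9 / 10 <= expR (- 10^-1) :> R.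
  by apply: le_trans (expR_ge1Dx _); lra.
have h2 : expR (10^-1) <= 10 / 9 :> R.
  rewrite -[expR _]invrK -expRN -[10 / 9]invrK lef_pV2 ?posrE ?expR_gt0 ?invr_gt0//.
  by apply: le_trans h; rewrite invf_div.
have -> : expR 1 = expR (10^-1) ^+ 10 :> R by rewrite -expRM_natl mulfV.
apply: (@le_trans _ _ ((10 / 9) ^+ 10)); first by rewrite ler_pXn2r ?nnegrE ?expR_ge0.
lra.
Qed.

Lemma sqrt2_le : Num.sqrt 2 <= 17 / 12 :> R.
Proof.
have h : 0 <= 17 / 12 :> R by lra.
by rewrite -[leRHS](ger0_norm h) -sqrtr_sqr ler_wsqrtr//; lra.
Qed.

Lemma geometric_decay (x : nat -> R) N :
  (forall i, (1 <= i < N)%N -> x i.+1 * expR 1 <= x i) ->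
  forall j, (j < N)%N -> x j.+1 * expR j%:R <= x 1%N.
Proof.
move=> H; elim=> [|j IH] jN; first by rewrite expR0 mulr1.
apply: le_trans (IH (ltnW jN)).
rewrite -natr1 addrC expRD mulrA; apply: ler_wpM2r; first exact: expR_ge0.
by apply: H; rewrite jN.
Qed.

(** The inverses grow by a factor at least [e], so the last one dominates a geometric series of
    ratio [1/e]. *)
Lemma sum_inv_le (x : nat -> R) (e : R) N : 1 < e ->
  (forall i, (1 <= i <= N)%N -> 0 < x i) ->
  (forall i, (1 <= i < N)%N -> x i.+1 * e <= x i) ->
  forall j, (0 < j <= N)%N ->
  \sum_(1 <= i < j.+1) (x i)^-1 <= e / (e - 1) * (x j)^-1.
Proof.
move=> e1 xp H; elim=> // -[_|j IH] jN.
  rewrite big_nat1 ler_peMl ?invr_ge0 ?(ltW (xp _ _))//.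
  by rewrite ler_pdivlMr ?subr_gt0//; lra.
rewrite big_nat_recr //=.
have xj := xp j.+1 (ltnW jN); have xj2 := xp j.+2 jN.
apply: le_trans (lerD (IH (ltnW jN)) (lexx _)) _.
have h : (x j.+1)^-1 <= e^-1 * (x j.+2)^-1.
  by rewrite -invfM lef_pV2 ?posrE ?mulr_gt0//; [rewrite mulrC H|lra].
have e0 : e != 0 by rewrite gt_eqF//; lra.
have e2 : e - 1 != 0 by rewrite gt_eqF// subr_gt0.
have -> : e / (e - 1) * (x j.+2)^-1 =
    e / (e - 1) * (e^-1 * (x j.+2)^-1) + (x j.+2)^-1.
  by field; rewrite e0 e2 gt_eqF.
by rewrite lerD2r; apply: ler_wpM2l h; rewrite divr_ge0//; lra.
Qed.

End Numerics.

Section Run.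
Variables (R : realType) (m n : nat) (Kp : set 'cV[R]_n).
Variables (A : 'M[R]_(m, n)) (b : 'cV[R]_m) (c : 'cV[R]_n).
Hypothesis hK : closed_convex_cone Kp.
Hypothesis hA : A != 0.
Hypothesis hslater : slater Kp A b c.
Hypothesis hc : A *m c = 0.
Variables (epscons epsgap : R).
Hypotheses (hcons : 0 < epscons) (hgap : 0 < epsgap).

Local Notation tau := (kappa A)^-1.
Local Notation sigma := (lambda_max A * lambda_min A)^-1.
Local Notation beta := (expR 1)^-1.
Local Notation "'Mn' z" := (Mnorm A tau sigma z) (at level 10, z at level 9).
Local Notation avg := (pdhg_avg Kp A b c tau sigma).
Local Notation rho := (Defs.rho Kp A b c tau sigma).
Local Notation w_of := (w_of_z A c).
Local Notation Wstar := (Defs.Wstar Kp A b c).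
Local Notation d0 := (Dist 0 Wstar).
Local Notation near := (near_optimal Kp A b c).
Local Notation admissible := (admissible Kp A b c).
Local Notation s2k := (Num.sqrt 2 * Num.sqrt (kappa A)).
Local Notation D := (Defs.D Kp A b c).
Local Notation dH := (Defs.dH Kp A b c).
Local Notation radius := (Defs.conic_radius Kp A b c).
Local Notation restart := (restart_cond Kp A b c tau sigma beta).
Local Notation first := (first_restart Kp A b c tau sigma beta).
Local Notation run := (rPDHG_run Kp A b c tau sigma beta 0).
Local Notation within := (within_tol Kp A b c epscons epsgap).
Local Notation total := (total_iterations Kp A b c tau sigma beta 0 epscons epsgap).
Local Notation invt := (inv_tol Kp A b c epscons epsgap).
Implicit Types (z : nat -> 'cV[R]_(n + m)) (l : nat -> nat) (N T : nat).

Let k0 := kappa_gt0 hA.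
Let s2k0 : 0 <= s2k. Proof. by rewrite mulr_ge0 ?sqrtr_ge0. Qed.

Let C_ge0 : 0 <= 4 * expR 1 * Num.sqrt 2 * kappa A.
Proof. by apply: mulr_ge0 (ltW k0); rewrite !mulr_ge0 ?sqrtr_ge0 ?expR_ge0. Qed.

(** In a run, for [i > 0], the iterate is an average, so [rho] is finite and [fine] loses
    nothing. *)
Definition outer_gap z i : R := fine (rho (Mn (z i - z i.-1)) (z i)).

(* The common bound on the primal and dual residuals of the i-th outer iterate. *)
Definition outer_res z i : R := Num.sqrt (kappa A) * outer_gap z i.

Lemma sqrt_kappa_sqr : Num.sqrt (kappa A) * Num.sqrt (kappa A) = kappa A.
Proof. by rewrite -expr2 sqr_sqrtr// ltW. Qed.

Lemma run_facts N z l : run N z l -> forall i, (i <= N)%N ->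
  admissible (z i) /\ ((0 < i)%N ->
  [/\ 0 <= outer_gap z i, rho (Mn (z i - z i.-1)) (z i) = (outer_gap z i)%:E,
      outer_gap z i <= 2 * Mn (z i - z i.-1) / (l i.-1)%:R
    & near (outer_res z i) (w_of (z i))]).
Proof.
move=> [z0 H]; elim=> [|i IH] iN; first by rewrite z0; split=> //; exact: admissible0.
have [ai _] := IH (ltnW iN); have [[l1 _ _] zi] := H i iN.
split; first by rewrite zi; exact: avg_admissible.
move=> _ /=; have [P [P0 rP Ple]] := avg_rho_fin b c hK hA (z i) l1.
have PE : outer_gap z i.+1 = P by rewrite /outer_gap /= zi rP.
rewrite /outer_res PE zi; split=> //.
exact: avg_near_optimal.
Qed.

Lemma run_first N z l : (0 < N)%N -> run N z l -> l 0%N = 1%N.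
Proof. by move=> N0 [_ /(_ 0%N N0)[[_ [[_ ->]//|[//]] _] _]]. Qed.

Lemma outer_res1 N z l : (0 < N)%N -> run N z l ->
  outer_res z 1 <= 4 * Num.sqrt 2 * kappa A * d0.
Proof.
move=> N0 rn; have [_ /(_ isT)[_ _ h _]] := run_facts rn N0.
have [z0 H] := rn; have [_ z1] := H 0%N N0.
move: h; rewrite /= (run_first N0 rn) divr1 => h.
have := admissible_move0 hK hA hslater hc (ltn0Sn 0) (admissible0 A b c hK).
have -> : avg 0 1 - 0 = z 1%N - z 0%N by rewrite z1 (run_first N0 rn) z0.
move=> h2; rewrite /outer_res.
have -> : 4 * Num.sqrt 2 * kappa A * d0 = Num.sqrt (kappa A) * (2 * (2 * s2k * d0)).
  by rewrite -[X in _ * X * d0]sqrt_kappa_sqr; ring.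
by apply: ler_wpM2l; [exact: sqrtr_ge0|lra].
Qed.

Lemma restartE z i k : (0 < i)%N -> restart z i k <->
  (rho (Mn (avg (z i) k - z i)) (avg (z i) k)
    <= beta%:E * rho (Mn (z i - z i.-1)) (z i))%E.
Proof. by move=> i0; split=> [[[i00]|[]]//|h]; [rewrite i00 in i0|right]. Qed.

Lemma outer_res_decay N z l : run N z l -> forall i, (1 <= i < N)%N ->
  outer_res z i.+1 * expR 1 <= outer_res z i.
Proof.
move=> rn i /andP[i1 iN].
have [_ /(_ isT)[_ r2 _ _]] := run_facts rn iN.
have [_ /(_ i1)[_ r1 _ _]] := run_facts rn (ltnW iN).
have [_ /(_ i iN)[[_ /restartE-/(_ i1) + _] zi]] := rn.
rewrite -zi r1 [X in (X <= _)%E]r2 -EFinM lee_fin => h.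
rewrite /outer_res -mulrA; apply: ler_wpM2l; first exact: sqrtr_ge0.
by rewrite mulrC -ler_pdivlMl// expR_gt0.
Qed.

(** If [k] does not trigger a restart, the gap of the k-th average exceeds [outer_gap / e], while
    [avg_rho_le] and [admissible_move] bound it above by a multiple of the distance over [k]. *)
Lemma no_restart_bound z i k : (0 < i)%N -> admissible (z i) ->
  rho (Mn (z i - z i.-1)) (z i) = (outer_gap z i)%:E ->
  (forall j, (1 <= j <= k)%N -> ~ restart z i j) ->
  k%:R * outer_res z i <=
    4 * expR 1 * Num.sqrt 2 * kappa A * Dist (w_of (z i)) Wstar.
Proof.
move=> i0 ai rP nr.
have D0 : 0 <= Dist (w_of (z i)) Wstar by apply: Dist_ge0; exact: Wstar_nonempty.
have e0 : 0 < expR 1 :> R by exact: expR_gt0.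
case: k nr => [|k] nr.
  by rewrite mul0r mulr_ge0.
have nk : ~ restart z i k.+1 by apply: nr; rewrite leqnn.
have h : ((beta * outer_gap z i)%:E <
    rho (Mn (avg (z i) k.+1 - z i)) (avg (z i) k.+1))%E.
  rewrite ltNge; apply/negP => h; apply: nk; apply/restartE => //.
  by rewrite rP -EFinM.
have := lt_le_trans h (avg_rho_le b c hK hA (z i) (ltn0Sn k)).
rewrite lte_fin ltr_pdivlMr ?ltr0n// => h1.
have h2 := admissible_move hK hA hslater hc (ltn0Sn k) ai.
have h3 : outer_gap z i * k.+1%:R <= expR 1 * (4 * s2k * Dist (w_of (z i)) Wstar).
  rewrite -ler_pdivrMl//; lra.
rewrite /outer_res.
have -> : k.+1%:R * (Num.sqrt (kappa A) * outer_gap z i) =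
  Num.sqrt (kappa A) * (outer_gap z i * k.+1%:R) by ring.
have -> : 4 * expR 1 * Num.sqrt 2 * kappa A * Dist (w_of (z i)) Wstar =
    Num.sqrt (kappa A) * (expR 1 * (4 * s2k * Dist (w_of (z i)) Wstar)).
  by rewrite -[X in _ * X * Dist _ _]sqrt_kappa_sqr; ring.
by apply: ler_wpM2l => //; exact: sqrtr_ge0.
Qed.

Lemma inv_tol_gt0 : 0 < invt.
Proof. by rewrite /inv_tol lt_max divr_gt0. Qed.

Lemma outer_res_tol N z l : run N z l -> forall i, (0 < i <= N)%N ->
  ~ within (z i) -> 1 < outer_res z i * invt.
Proof.
move=> rn i /andP[i0 iN] nw; have [_ /(_ i0)[P0 _ _ ni]] := run_facts rn iN.
rewrite ltNge; apply/negP => h; apply: nw.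
by apply: near_within_tol ni h _ => //; rewrite mulr_ge0 ?sqrtr_ge0.
Qed.

Lemma inner_length N z l delta : 0 < delta -> run N z l ->
  forall i, (0 < i < N)%N -> ~ within (z i) ->
  (l i)%:R <= 1 + 4 * expR 1 * Num.sqrt 2 * kappa A *
    ((3 + 2 * Num.sqrt 2) * (D delta / radius delta) + dH delta * (outer_res z i)^-1).
Proof.
move=> dp rn i /andP[i0 iN] nw.
have [ai /(_ i0)[P0 rP _ ni]] := run_facts rn (ltnW iN).
have x0 : 0 < outer_res z i.
  have := @outer_res_tol N z l rn i; rewrite i0 (ltnW iN) => /(_ isT nw).
  by have := inv_tol_gt0; nra.
have [[l1 _ nr] _] := (proj2 rn) i iN.
(* The last step does trigger the restart, so the bound applies to [l i - 1]; hence the additive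
   1. *)
have h := @no_restart_bound z i (l i).-1 i0 ai rP.
have {}h : ((l i)%:R - 1) * outer_res z i <=
    4 * expR 1 * Num.sqrt 2 * kappa A * Dist (w_of (z i)) Wstar.
  have -> : (l i)%:R - 1 = (l i).-1%:R :> R by rewrite -subn1 natrB.
  apply: h => j /andP[j1 jl]; apply: nr.
  by rewrite j1 (leq_ltn_trans jl)// ltn_predL.
have e0 : 0 < expR 1 :> R by exact: expR_gt0.
set C := 4 * expR 1 * Num.sqrt 2 * kappa A in h *.
have C0 : 0 <= C by exact: C_ge0.
have := Dist_Wstar_le hK hA hslater hc dp (ltW x0) ni.
move=> /(ler_wpM2l C0) => h2.
rewrite -lerBlDl -(ler_pM2r x0).
apply: le_trans h _.
apply: le_trans h2 _; rewrite le_eqVlt; apply/orP; left; apply/eqP.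
by field; rewrite !gt_eqF//; exact: conic_radius_gt0.
Qed.

(** The residual starts at most at [4 sqrt 2 kappa d0], loses a factor [e] per restart and still
    exceeds [1 / invt] at index [N]. Only [N - 1] decays separate indices 1 and [N], so 17 has to
    bound [4 sqrt 2 e]. *)
Lemma outer_count N z l : run N.+1 z l -> (forall i, (i <= N)%N -> ~ within (z i)) ->
  1 <= ln (17 * kappa A * d0 * invt) /\ N%:R <= ln (17 * kappa A * d0 * invt).
Proof.
move=> rn nw.
have z0 : z 0%N = 0 by case: rn.
have di : 1 < d0 * invt.
  by apply: start_within_tol => //; rewrite -z0; exact: nw.
have k1 := kappa_ge1 hA.
have Y1 : 1 <= kappa A * (d0 * invt) by nra.
set L := 17 * kappa A * d0 * invt.
have LE : L = 17 * (kappa A * (d0 * invt)) by rewrite /L; ring.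
have L0 : 0 < L by rewrite LE; lra.
have e3 := expR1_le R; have e2 := expR1_ge2 R; have s2 := sqrt2_le R.
have s0 : 0 <= Num.sqrt 2 :> R by exact: sqrtr_ge0.
have ge1 : 1 <= ln L by rewrite -ler_expR lnK ?posrE//; lra.
split=> //; case: N rn nw => [|N] rn nw; first by rewrite (le_trans ler01).
have xt : 1 < outer_res z N.+1 * invt.
  by apply: (outer_res_tol rn); [rewrite leqnSn|exact: nw].
have dec := geometric_decay (outer_res_decay rn) (ltnW (ltnSn N.+1)).
have x1 := outer_res1 (ltn0Sn _) rn.
have i0 := inv_tol_gt0.
rewrite -ler_expR lnK ?posrE// -natr1 expRD LE.
have h : expR N%:R <= 4 * Num.sqrt 2 * (kappa A * (d0 * invt)).
  have -> : 4 * Num.sqrt 2 * (kappa A * (d0 * invt)) =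
    4 * Num.sqrt 2 * kappa A * d0 * invt by ring.
  apply: (@le_trans _ _ (outer_res z 1 * invt)); last by rewrite ler_pM2r.
  apply: (@le_trans _ _ (outer_res z N.+1 * expR N%:R * invt)); last by rewrite ler_pM2r.
  by rewrite mulrAC ler_peMl ?expR_ge0// ltW.
apply: (@le_trans _ _ (4 * Num.sqrt 2 * (kappa A * (d0 * invt)) * expR 1)).
  by rewrite ler_pM2r// expR_gt0.
have : Num.sqrt 2 * expR 1 <= 17 / 4 :> R by nra.
move: (kappa A * _) Y1 => Y Y1; nra.
Qed.

Lemma run_total_le N z l delta : 0 < delta -> run N.+1 z l ->
  (forall i, (i <= N)%N -> ~ within (z i)) ->
  (\sum_(0 <= i < N.+1) l i)%:R <= Tbound Kp A b c epscons epsgap delta.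
Proof.
move=> dp rn nw; have [L1 NL] := outer_count rn nw.
rewrite /Tbound; set L := ln _ in L1 NL *.
have e3 := expR1_le R; have e2 := expR1_ge2 R; have s2 := sqrt2_le R.
have s0 : 0 <= Num.sqrt 2 :> R by exact: sqrtr_ge0.
have ss : Num.sqrt 2 * Num.sqrt 2 = 2 :> R by rewrite -expr2 sqr_sqrtr.
have rD := conic_radius_le_D hK hA hslater hc dp.
have r0 := conic_radius_gt0 hK hA hslater hc dp.
have DR : 1 <= D delta / radius delta by rewrite ler_pdivlMr// mul1r.
have dH0 := dH_ge0 hK hA hslater hc dp.
have k1 := kappa_ge1 hA; have i0 := inv_tol_gt0.
set C := 4 * expR 1 * Num.sqrt 2 * kappa A.
have C0 : 0 <= C by exact: C_ge0.
rewrite natr_sum big_ltn// (run_first (ltn0Sn N) rn).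
have h1 : \sum_(1 <= i < N.+1) (l i)%:R <=
    \sum_(1 <= i < N.+1) (1 + C * ((3 + 2 * Num.sqrt 2) * (D delta / radius delta))
      + C * dH delta * (outer_res z i)^-1).
  apply: ler_sum_nat => i /andP[i1 iN].
  have := inner_length dp rn; rewrite -/C => /(_ i); rewrite i1 iN.
  by move=> /(_ isT (nw i iN)); rewrite mulrDr !addrA mulrA.
have h2 : \sum_(1 <= i < N.+1) (outer_res z i)^-1 <= expR 1 / (expR 1 - 1) * invt.
  clear NL h1; case: N rn nw => [|N] rn nw.
    by rewrite big_geq// mulr_ge0 ?divr_ge0// ?(ltW i0)//; lra.
  have xt i : (1 <= i <= N.+1)%N -> 1 < outer_res z i * invt.
    move=> /andP[i1 iN]; apply: (outer_res_tol rn); last exact: nw.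
    by rewrite i1 (leq_trans iN).
  have xp i : (1 <= i <= N.+1)%N -> 0 < outer_res z i.
    by move=> /xt; nra.
  have dec i : (1 <= i < N.+1)%N -> outer_res z i.+1 * expR 1 <= outer_res z i.
    by move=> /andP[i1 iN]; apply: (outer_res_decay rn); rewrite i1 ltnW.
  have e1 : 1 < expR 1 :> R by lra.
  apply: le_trans (sum_inv_le e1 xp dec (j := N.+1) _) _; first by rewrite leqnn.
  apply: ler_wpM2l; first by rewrite divr_ge0//; lra.
  have xN := xp N.+1 (leqnn _).
  by rewrite -[leLHS]mul1r ler_pdivrMr// ltW// mulrC xt ?leqnn.
(* This is [4 sqrt 2 e^2 <= 26 (e - 1)], checked from [2 <= e <= 29/10] and [sqrt 2 <= 17/12]. *)
have h3 : C * (expR 1 / (expR 1 - 1)) <= 26 * kappa A.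
  rewrite mulrA ler_pdivrMr; last by lra.
  have : 4 * expR 1 * Num.sqrt 2 * expR 1 <= 26 * (expR 1 - 1) :> R by nra.
  by rewrite /C => h; nra.
have h4 : C * (3 + 2 * Num.sqrt 2) <= 96 * kappa A.
  have : 4 * expR 1 * Num.sqrt 2 * (3 + 2 * Num.sqrt 2) <= 96 :> R by nra.
  by rewrite /C => h; nra.
rewrite big_split/= -mulr_sumr sumr_const_nat subn1 /= -[X in X + _]mulr_natl in h1.
have h5 : C * dH delta * (\sum_(1 <= i < N.+1) (outer_res z i)^-1) <=
    26 * kappa A * dH delta * invt.
  apply: (@le_trans _ _ (C * dH delta * (expR 1 / (expR 1 - 1) * invt))).
    by apply: ler_wpM2l h2; rewrite mulr_ge0.
  have -> : C * dH delta * (expR 1 / (expR 1 - 1) * invt) =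
    C * (expR 1 / (expR 1 - 1)) * (dH delta * invt) by ring.
  by rewrite -(mulrA _ (dH delta)); apply: ler_wpM2r h3; rewrite mulr_ge0// ltW.
set q := D delta / radius delta in DR h1 *; clearbody q.
have h6 : C * ((3 + 2 * Num.sqrt 2) * q) <= 96 * (kappa A * q).
  by rewrite (mulrA C) (mulrA 96); apply: ler_wpM2r h4; lra.
have X1 : 1 <= kappa A * q by nra.
have N0 : 0 <= N%:R :> R by [].
(* The additive 1 is absorbed by [kappa q >= 1]: 96 becomes 97. *)
have h7 : N%:R * (1 + C * ((3 + 2 * Num.sqrt 2) * q)) <= L * (97 * (kappa A * q)).
  have hp : 0 <= C * ((3 + 2 * Num.sqrt 2) * q).
    by apply: mulr_ge0 => //; apply: mulr_ge0; lra.
  by apply: ler_pM => //; lra.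
(* This absorbs the single step of the first outer iteration, so 98 suffices. *)
have h8 : 1 <= L * (kappa A * q) by nra.
lra.
Qed.

Lemma restart_cond_ext z z' i k : z i = z' i -> z i.-1 = z' i.-1 ->
  restart z i k -> restart z' i k.
Proof. by rewrite /restart_cond => -> ->. Qed.

Lemma first_restart_ext z z' i k : z i = z' i -> z i.-1 = z' i.-1 ->
  first z i k -> first z' i k.
Proof.
move=> e1 e2 [h1 h2 h3]; split=> // [|j hj]; first exact: restart_cond_ext h2.
by move=> h; apply: (h3 j hj); exact: restart_cond_ext h.
Qed.

(** An inner loop that never restarts would satisfy [no_restart_bound] for every [k], which is
    impossible because the residual is positive outside the tolerances. *)
Lemma first_restart_ex N z l : run N z l -> ~ within (z N) -> exists k, first z N k.
Proof.
move=> rn nw.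
suff [k [k1 hk]] : exists k, (1 <= k)%N /\ restart z N k.
  have ex : exists k, (1 <= k)%N && `[< restart z N k >].
    by exists k; rewrite k1; apply/asboolP.
  case: (ex_minnP ex) => j /andP[j1 /asboolP hj] jmin.
  exists j; split=> // i /andP[i1 ij] hi.
  by have := jmin i; rewrite i1 leqNgt ij => /(_ (asboolT hi)).
case: N rn nw => [|N] rn nw; first by exists 1%N; split=> //; left.
apply: contrapT => H.
have [ai /(_ isT)[P0 rP _ _]] := run_facts rn (leqnn N.+1).
have xt := outer_res_tol rn (i := N.+1) (leqnn _) nw; have i0 := inv_tol_gt0.
have x0 : 0 < outer_res z N.+1 by nra.
set B := 4 * expR 1 * Num.sqrt 2 * kappa A * Dist (w_of (z N.+1)) Wstar.
have hB k : k%:R * outer_res z N.+1 <= B.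
  apply: no_restart_bound => // j /andP[j1 _] hj.
  by apply: H; exists j.
have := hB (Num.truncn (B / outer_res z N.+1)).+1.
rewrite -ler_pdivlMr// leNgt => /negP; apply.
exact: truncnS_gt.
Qed.

Lemma run_extend N z l : run N z l -> ~ within (z N) ->
  exists z' l', run N.+1 z' l' /\ forall i, (i <= N)%N -> z' i = z i.
Proof.
move=> rn nw; have [k hk] := first_restart_ex rn nw; have [z0 H] := rn.
exists (fun i => if (i <= N)%N then z i else avg (z N) k).
exists (fun i => if (i < N)%N then l i else k).
split=> [|i ->//]; split=> //= i; rewrite ltnS => iN.
have iN' : (i.-1 <= N)%N := leq_trans (leq_pred i) iN.
split.
  apply: (@first_restart_ext z) => /=; rewrite ?iN ?iN'//.
  case: ltnP => [/H[]//|Ni]; suff -> : i = N by [].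
  by apply/eqP; rewrite eqn_leq iN.
rewrite iN; case: ltnP => [/H[]//|Ni].
by suff -> : i = N; [|apply/eqP; rewrite eqn_leq iN].
Qed.

(** If the tolerances were never met, runs could be extended indefinitely, against the logarithmic
    bound of [outer_count]. *)
Lemma total_ex : exists T, total T.
Proof.
apply: contrapT => H.
have long N : exists z l, run N z l /\ forall i, (i < N)%N -> ~ within (z i).
  elim: N => [|N [z [l [rn nw]]]]; first by exists (fun=> 0), (fun=> 0%N).
  have nwN : ~ within (z N).
    move=> wN; apply: H; exists (\sum_(0 <= i < N) l i)%N, N, z, l; split=> //.
  have [z' [l' [rn' zz']]] := run_extend rn nwN.
  exists z', l'; split=> // i; rewrite ltnS => iN; rewrite zz'//.
  by move: iN; rewrite leq_eqVlt => /predU1P[->//|/nw].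
set L := ln (17 * kappa A * d0 * invt).
(* The length is [N + 1] with [N = truncn L + 1 > L], which contradicts [N <= L]. *)
have [z [l [rn nw]]] := long (Num.truncn L).+2.
have [_] := outer_count rn (fun i iN => nw i iN).
by rewrite leNgt => /negP; apply; exact: truncnS_gt.
Qed.

Lemma total_le T delta : total T -> 0 < delta ->
  T%:R <= Num.max 0 (Tbound Kp A b c epscons epsgap delta).
Proof.
move=> [N [z [l [rn _ nw ->]]]] dp; case: N rn nw => [|N] rn nw.
  by rewrite big_geq// le_max lexx.
by rewrite le_max (run_total_le dp rn) ?orbT.
Qed.

Lemma total_gt0_le T delta : total T -> (0 < T)%N -> 0 < delta ->
  T%:R <= Tbound Kp A b c epscons epsgap delta.
Proof.
move=> [N [z [l [rn _ nw ->]]]]; case: N rn nw => [|N] rn nw.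
  by rewrite big_geq.
by move=> _ dp; exact: run_total_le dp rn nw.
Qed.

End Run.

(* The positive parts [Num.max 0 _] matter only if T = 0: for large tolerances
   the starting point is already acceptable and the logarithm in Tbound is
   negative. For T >= 1 they can be dropped. *)
Theorem theorem3p1 (R : realType) (m n : nat) (Kp : set 'cV[R]_n)
    (A : 'M[R]_(m, n)) (b : 'cV[R]_m) (c : 'cV[R]_n)
    (hK : closed_convex_cone Kp) (hA : A != 0)
    (hslater : slater Kp A b c) (hc : A *m c = 0)
    (epscons epsgap : R) (hcons : 0 < epscons) (hgap : 0 < epsgap) :
  let tau := 1 / kappa A in
  let sigma := 1 / (lambda_max A * lambda_min A) in
  let beta := 1 / expR 1 in
  let total := total_iterations Kp A b c tau sigma beta 0 epscons epsgap in
  let Tdelta := Tbound Kp A b c epscons epsgap in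
  (exists T : nat, total T) /\
  (forall T : nat, total T ->
     (forall delta : R, 0 < delta -> T%:R <= Num.max 0 (Tdelta delta)) /\
     T%:R <= Num.max 0 (inf [set Tdelta delta | delta in [set d : R | 0 < d]])).
Proof.
cbv zeta; rewrite !div1r; split; first exact: total_ex.
move=> T hT; split=> [delta dp|]; first exact: total_le.
case: T hT => [|T] hT; first by rewrite le_max lexx.
(* For [T >= 1] the number [T] is a lower bound of all [Tdelta delta], hence of their infimum. *)
rewrite le_max; apply/orP; right; apply: lb_le_inf.
  by exists (Tbound Kp A b c epscons epsgap 1), 1 => /=.
by move=> _ [delta /= dp <-]; exact: total_gt0_le.
Qed.
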